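(* Let $\mathcal{C}$ be a class of piecewise expanding maps of $[0,1]$ such that: (1) $\mathcal{C}$ satisfies $(D_r)$ for some $r\ge 1$ and satisfies (Dec); (2) there exist $\lambda>1$ and $M\ge 1$ such that $\inf|T'|\ge\lambda$ and $\sup|T''|\le M$ for all $T\in\mathcal{C}$; (3) there exists $N\ge 1$ such that $\sharp\mathcal{A}_T\le N$ for all $T\in\mathcal{C}$. Let $(T_n)_{n\ge 1}$ be a sequence in $\mathcal{C}$ verifying (Min). Then there exist constants $C_1,C_2>0$ such that for all measurable $A\subset[0,1]$ with $m(A)>0$ and all $n\ge1$, the function $$Z_n(x)=\inf_{y\in A}\frac1n\sum_{k=0}^{n-1}|T_1^kx-T_1^ky|$$ satisfies, for any $t>0$, $$m\left(Z_n>C_1\frac{\sqrt{|\log m(A)|}}{\sqrt n}+\frac{t}{\sqrt n}\right)\le e^{-C_2t^2}.$$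
   Context: $m$ is Lebesgue measure on $[0,1]$ with its Borel $\sigma$-algebra. A piecewise expanding map is a map $T:[0,1]\to[0,1]$ with $\inf_x|T'(x)|>1$ for which there is a finite partition $\mathcal{A}_T$ of $[0,1]$ into intervals with disjoint interiors such that $T$ can be extended to a $C^2$ map on a neighborhood of each element of $\mathcal{A}_T$. Its transfer operator $P_T:L^1(m)\to L^1(m)$ is characterized by $\int P_Tf\cdot g\,dm=\int f\cdot g\circ T\,dm$ for $f\in L^1(m)$, $g\in L^\infty(m)$. For $f\in L^1(m)$, $\mathrm{V}f$ is the infimum of the total variations on $[0,1]$ of the functions $\bar f$ with $\bar f=f$ $m$-a.e.; $\mathrm{BV}=\{f\in L^1(m):\mathrm{V}f<\infty\}$ with norm $\|f\|_{\mathrm{BV}}=\mathrm{V}f+\|f\|_{L^1_m}$. $(D_r)$: a class $\mathcal{C}$ of piecewise expanding maps satisfies $(D_r)$, $r\ge1$ an integer, if there are constants $0<\rho_r<1$, $M_0>0$, $C_r>0$ such that $\|P_Tf\|_{\mathrm{BV}}\le M_0\|f\|_{\mathrm{BV}}$ for all $T\in\mathcal{C}$, $f\in\mathrm{BV}$, and $\|P_{T_r}\cdots P_{T_1}f\|_{\mathrm{BV}}\le\rho_r\|f\|_{\mathrm{BV}}+C_r\|f\|_{L^1_m}$ for all $T_1,\ldots,T_r\in\mathcal{C}$, $f\in\mathrm{BV}$. (Dec): $\mathcal{C}$ satisfies (Dec) if there exist $0<\theta<1$ and $K_0>0$ such that for all $l\ge1$, all $T_1,\ldots,T_l\in\mathcal{C}$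 and all $f\in\mathrm{BV}$ with $\int f\,dm=0$, $\|P_{T_l}\cdots P_{T_1}f\|_{\mathrm{BV}}\le K_0\theta^l\|f\|_{\mathrm{BV}}$. For a sequence $(T_n)_{n\ge1}$ and $n\le k$: $T_n^k=T_k\circ\cdots\circ T_n$, $P_n^k=P_{T_k}\cdots P_{T_n}$, and $T_1^0=\mathrm{Id}$. (Min): the sequence $(T_n)$ satisfies (Min) if there is $\delta>0$ with $P_1^n\mathbf{1}\ge\delta$ ($m$-a.e.) for all $n\ge1$. *)

(* Defs.v *)
From HB Require Import structures.
From mathcomp Require Import all_boot all_order all_algebra.
From mathcomp Require Import all_classical all_reals all_analysis.
Set Implicit Arguments.
Unset Strict Implicit.
Unset Printing Implicit Defensive.
Import Order.TTheory GRing.Theory Num.Theory.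
Import numFieldNormedType.Exports.
Local Open Scope ring_scope.
Local Open Scope ereal_scope.
Local Open Scope classical_set_scope.

(* Points, maps and functions on [0,1] are represented by [R] and [R -> R];   *)
(* every notion below only depends on the values taken on [0,1]. The measure  *)
(* m is Lebesgue measure on the Borel sets of [R], integrated over [I01].     *)
Section PiecewiseExpanding.
Variable R : realType.
Implicit Types (T S f g h : R -> R) (P : set (set R)).

Definition I01 : set R := `[0%R, 1%R].

Local Notation leb := (@lebesgue_measure R).

Definition C2_on (U : set R) S := forall x, U x ->
  [/\ derivable S x 1%R, derivable S^`() x 1%R & {for x, continuous S^`(2)}].

Definition interval_partition P :=
  [/\ finite_set P,
      \bigcup_(J in P) J = I01,
      forall J, P J -> J !=set0 /\ is_interval J &
      trivIset P (fun J => J°)].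

(* A map need not be continuous at the endpoints of the pieces, so T' and T'' *)
(* are only considered in the interiors of the pieces.                        *)
Definition inner_points P : set R := \bigcup_(J in P) J°.

Definition inf_abs_deriv T P : \bar R :=
  ereal_inf [set `|T^`()%classic x|%:E | x in inner_points P].

Definition sup_abs_deriv2 T P : \bar R :=
  ereal_sup [set `|T^`(2)%classic x|%:E | x in inner_points P].

(* Two closed pieces may share an endpoint at which T jumps: the extension of *)
(* a branch is a C^2 map near the closed piece agreeing with T inside it.     *)
Definition piecewise_expanding T P :=
  [/\ forall x, I01 x -> I01 (T x),
      interval_partition P,
      forall J, P J -> exists (U : set R) S,
        [/\ open U, closure J `<=` U, C2_on U S & forall x, J° x -> T x = S x] &
      1 < inf_abs_deriv T P].

Definition L1 f := leb.-integrable I01 (EFin \o f).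

Definition Linfty g := measurable_fun I01 g /\
  exists K : R, {ae leb, forall x, I01 x -> (`|g x| <= K)%R}.

Definition is_transfer T f h := L1 h /\
  forall g, Linfty g ->
    \int[leb]_(x in I01) (h x * g x)%:E =
    \int[leb]_(x in I01) (f x * g (T x))%:E.

(* A representative of the a.e. class P_T f; it exists whenever f is in L^1   *)
(* and T is nonsingular, in particular piecewise expanding.                   *)
Definition transfer T f : R -> R := xget (cst 0%R) [set h | is_transfer T f h].

Definition ess_variation f : \bar R :=
  ereal_inf [set total_variation 0%R 1%R g | g in [set g | ae_eq leb I01 g f]].

Definition BV f := L1 f /\ ess_variation f < +oo.

Definition norm_L1 f : \bar R := \int[leb]_(x in I01) `|f x|%:E.

Definition norm_BV f : \bar R := ess_variation f + norm_L1 f.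

(* Sequences are indexed from 1: the value [Ts 0] is never used.              *)
Implicit Type Ts : nat -> R -> R.

Fixpoint iter_map Ts (n : nat) : R -> R :=
  if n is k.+1 then Ts k.+1 \o iter_map Ts k else id.

Fixpoint iter_transfer Ts (n : nat) f : R -> R :=
  if n is k.+1 then transfer (Ts k.+1) (iter_transfer Ts k f) else f.

Implicit Type C : set (R -> R).

Definition cond_D C (r : nat) := exists rho M0 Cr : R,
  [/\ (0 < rho < 1)%R, (0 < M0)%R, (0 < Cr)%R,
      forall T f, C T -> BV f ->
        norm_BV (transfer T f) <= M0%:E * norm_BV f &
      forall Ts f, (forall i, (1 <= i <= r)%N -> C (Ts i)) -> BV f ->
        norm_BV (iter_transfer Ts r f) <=
          rho%:E * norm_BV f + Cr%:E * norm_L1 f].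

Definition cond_Dec C := exists theta K0 : R,
  [/\ (0 < theta < 1)%R, (0 < K0)%R &
      forall (l : nat) Ts f, (1 <= l)%N ->
        (forall i, (1 <= i <= l)%N -> C (Ts i)) -> BV f ->
        \int[leb]_(x in I01) (f x)%:E = 0 ->
        norm_BV (iter_transfer Ts l f) <= (K0 * theta ^+ l)%:E * norm_BV f].

Definition cond_Min Ts := exists2 delta : R, (0 < delta)%R &
  forall n, (1 <= n)%N ->
    {ae leb, forall x, I01 x -> (delta <= iter_transfer Ts n (cst 1) x)%R}.

Definition mean_orbit_dist Ts (n : nat) (x y : R) : R :=
  (n%:R^-1 * \sum_(0 <= k < n) `|iter_map Ts k x - iter_map Ts k y|)%R.

Definition orbit_dist_to Ts (A : set R) (n : nat) (x : R) : R :=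
  inf [set mean_orbit_dist Ts n x y | y in A].

End PiecewiseExpanding.

(* Main.v *)
Require Import Defs.
From HB Require Import structures.
From mathcomp Require Import all_boot all_order all_algebra.
From mathcomp Require Import all_classical all_reals all_analysis.
From mathcomp Require Import measurable_realfun.
From mathcomp Require Import ring lra.
Import Order.TTheory GRing.Theory Num.Theory.
Import numFieldNormedType.Exports.
Local Open Scope classical_set_scope.
Local Open Scope card_scope.
Local Open Scope ring_scope.

(**
   Let mu be Lebesgue measure on [0,1] and kappa a function of orbits that is
   1/n-Lipschitz in each of its n coordinates. The sigma-algebras generated by
   T_1^p decrease with p, and Y_p = E[kappa | T_1^p] is a reverse martingale with
   Y_0 = kappa. Fix the coordinates z of index > p: kappa becomes a sum over
   i <= p of functions h_i of x_0, ..., x_i, each of size 1/n. Although h_i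
   oscillates wildly as a function of x_0, it is Lipschitz along the inverse
   branches of T_1^i, and the suprema of the weights of these branches have a
   bounded sum (bounded distortion, at most N cuts at each step, and the bound
   on the densities P_1^i 1 given by (D_r)); so P_1^i h_i has BV norm O(1/n),
   and by (Dec) and (Min) the contribution of h_i to Y_p differs from its mean by
   O(theta^(p-i)/n). Hence |Y_p - Y_{p+1}| = O(1/n), and Azuma's argument gives
   E exp(s (kappa - E kappa)) <= exp(V s^2 / n). For kappa = Z_n, which vanishes
   on A, this bound with s < 0 yields E Z_n <= 2 sqrt(V |log m(A)| / n), and with
   s > 0 the Gaussian tail beyond E Z_n.
*)

Set Implicit Arguments.
Unset Strict Implicit.
Unset Printing Implicit Defensive.

(** * Change of variables on a monotone piece *)

(** Freezing the coordinates of index > p is legitimate because all preimages of y under T_1^p share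
    them: they are functions of y alone. On a fibre z is thus the later orbit of y, so the estimate
    for frozen z must hold for this particular z. Each fixed z comes with its own null set; a
    countable dense family of sequences makes the null set common. Transfer operators act on classes
    modulo null sets, whereas the estimates need values on each inverse branch. They are carried out
    on explicit sums over branches, defined at every point, and duality identifies these sums a.e.
    with the operators in (D_r), (Dec) and (Min). Likewise Y_p is a quotient of two such sums, and
    the martingale property enters as E[Y_p g(T_1^p)] = E[kappa g(T_1^p)], tested on exponentials. A
    cut adds to the total weight only through the branches whose domain contains the cut point. Near
    that point their weights add up to at most the density P_1^i 1, which is why an upper bound on
    the densities is wanted. *)

Section change_of_variables.
Context d1 d2 (X : measurableType d1) (Y : measurableType d2) (R : realType).
Variables (mu : {measure set X -> \bar R}) (nu : {measure set Y -> \bar R}).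
Import HBNNSimple.

(** The hypothesis on sets is the case of indicators; linearity gives nonnegative simple functions,
    and monotone convergence the rest. *)
Lemma ge0_integral_image_density (D : set X) (V : set Y)
    (S : X -> Y) (f : X -> R) (H : Y -> \bar R) :
  measurable D -> measurable V -> measurable_fun D S -> S @` D `<=` V ->
  measurable_fun D f -> (forall x, D x -> 0 <= f x) ->
  (forall E, measurable E -> E `<=` V ->
     nu E = (\int[mu]_(x in D `&` S @^-1` E) (f x)%:E)%E) ->
  measurable_fun V H -> (forall y, V y -> 0 <= H y)%E ->
  (\int[nu]_(y in V) H y = \int[mu]_(x in D) (H (S x) * (f x)%:E))%E.
Proof.
move=> mD mV mS SDV mf f0 muE mH H0.
pose h := nnsfun_approx mV mH.
transitivity (limn (fun n => \int[nu]_(x in V) (h n x)%:E)%E).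
  rewrite -monotone_convergence//.
  - apply: eq_integral => y /set_mem Vy; apply/esym/cvg_lim => //.
    exact: cvg_nnsfun_approx.
  - by move=> n; apply/measurable_EFinP; exact: measurable_funP.
  - by move=> n y _; rewrite lee_fin.
  - by move=> y _ m n mn; rewrite lee_fin; exact/lefP/nd_nnsfun_approx.
have mhS n : measurable_fun D (fun x => h n (S x)).
  exact: (measurableT_comp (measurable_funPT (h n)) mS).
transitivity (limn (fun n => \int[mu]_(x in D) ((h n (S x))%:E * (f x)%:E))%E); last first.
  rewrite -monotone_convergence//.
  - apply: eq_integral => x /set_mem Dx; apply/cvg_lim => //.
    apply: cvgeZr; first by [].
    apply: cvg_nnsfun_approx => //.
    by apply: SDV; exists x.
  - move=> n; apply: emeasurable_funM; last exact/measurable_EFinP.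
    exact/measurable_EFinP.
  - by move=> n x Dx; rewrite mule_ge0 ?lee_fin ?f0.
  - move=> x Dx m n mn; rewrite lee_wpmul2r ?lee_fin ?f0//.
    exact/lefP/nd_nnsfun_approx.
congr (limn _); apply/funext => n.
transitivity (\sum_(r \in range (h n)) r%:E * nu (V `&` (h n @^-1` [set r])))%E.
  under eq_integral do rewrite fimfunE// -fsumEFin//.
  rewrite ge0_integral_fsum//; last 2 first.
  - by move=> r; apply/measurable_EFinP; exact: measurable_funM.
  - by move=> r x Vx; rewrite EFinM nnfun_muleindic_ge0.
  apply: eq_fsbigr => r _.
  rewrite integralZl_indic_nnsfun//.
  by rewrite integral_indic// setIC.
transitivity (\sum_(r \in range (h n)) \int[mu]_(x in D) (r%:E * ((\1_(h n @^-1` [set r]) (S x))%:E * (f x)%:E)))%E; last first.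
  rewrite -ge0_integral_fsum//.
  - apply: eq_integral => x _.
    rewrite [in RHS]fimfunE// -fsumEFin//.
    rewrite ge0_mule_fsuml; last first.
      by move=> r; rewrite EFinM nnfun_muleindic_ge0.
    by apply: eq_fsbigr => r _; rewrite EFinM muleA.
  - move=> r; apply: measurable_funeM; apply: emeasurable_funM; last exact/measurable_EFinP.
    by apply/measurable_EFinP; apply: measurableT_comp.
  - move=> r x Dx; rewrite muleA mule_ge0//; last by rewrite lee_fin f0.
    exact: nnfun_muleindic_ge0.
apply: eq_fsbigr => r /set_mem[z _ hzr].
have r0 : 0 <= r by rewrite -hzr.
rewrite ge0_integralZl//; last 2 first.
- apply: emeasurable_funM; last exact/measurable_EFinP.
  by apply/measurable_EFinP; apply: measurableT_comp.
- by move=> x Dx; rewrite mule_ge0// lee_fin ?f0//.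
congr (_ * _)%E.
rewrite muE; last 2 first.
- by apply: measurableI => //; exact: measurable_funPTI.
- by move=> y [].
rewrite setIC integral_mkcond [RHS]integral_mkcond.
apply: eq_integral => x _; rewrite !patchE.
case: ifPn => [/set_mem[[Vx /= hSx] Dx]|nx].
  by rewrite mem_set// indicE mem_set// mul1e.
case: ifPn => // /set_mem Dx; rewrite indicE memNset ?mul0e//= => hx.
move/negP: nx; apply; apply/mem_set; split => //; split => //.
by apply: SDV; exists x.
Qed.

End change_of_variables.

Lemma image_density_sigma_additive d1 d2 (X : measurableType d1)
    (Y : measurableType d2) (R : realType) (mu : {measure set X -> \bar R})
    (D : set X) (S : X -> Y) (f : X -> R) :
  measurable D -> measurable_fun D S -> measurable_fun D f ->
  (forall x, D x -> 0 <= f x) ->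
  semi_sigma_additive
    (fun E : set Y => (\int[mu]_(x in D `&` S @^-1` E) (f x)%:E)%E).
Proof.
move=> mD mS mf f0 F mF tF mUF.
have mDF n : measurable (D `&` S @^-1` F n) by exact: mS.
rewrite preimage_bigcup setI_bigcupr ge0_integral_bigcup//; last 3 first.
- apply/measurable_EFinP; apply: measurable_funS mf => //.
  by move=> x [n _ []].
- by move=> x [n _ [Dx _]]; rewrite lee_fin f0.
- move=> i j _ _ [x [[_ Fix] [_ Fjx]]]; apply: tF => //.
  by exists (S x).
apply: is_cvg_ereal_nneg_natsum => n _.
by apply: integral_ge0 => x [Dx _]; rewrite lee_fin f0.
Qed.

Section change_of_variables.
Context {R : realType}.
Local Notation mu := (@lebesgue_measure R).

Lemma lebesgue_measureD1 (A : set R) (r : R) : measurable A ->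
  mu (A `\ r) = mu A.
Proof.
move=> mA; have mAr : measurable (A `\ r) by exact: measurableD.
have := @integral_setD1 R (cst 1%E) r A mAr (measurable_cst _).
by rewrite !integral_cst// !mul1e.
Qed.

(** The point of [p, q] nearest to y, when p <= q. It truncates intervals to the range of a map and,
    later, moves rationals into [0, 1]. *)
Definition clip (p q y : R) := Num.max p (Num.min y q).

Lemma clip_bounds (p q y : R) : p < q -> p <= clip p q y <= q.
Proof.
move=> pq.
by rewrite le_max lexx/= ge_max (ltW pq)/= ge_min lexx orbT.
Qed.

Lemma clip_lt (p q y v : R) : p < v < q -> (clip p q y < v) = (y < v).
Proof.
move=> /andP[pv vq]; rewrite gt_max pv/= gt_min.
by rewrite [q < v]ltNge (ltW vq) orbF.
Qed.

Lemma clip_le (p q y z : R) : y <= z -> clip p q y <= clip p q z.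
Proof. by move=> yz; exact: le_max2 (lexx _) (le_min2 yz (lexx _)). Qed.

(** Both sides are measures of E. The fundamental theorem of calculus gives equality on half-open
    intervals, and uniqueness of Lebesgue measure extends it to Borel sets. *)
Lemma increasing_image_density (c d : R) (S : R -> R) : c < d ->
  (forall x, c <= x <= d -> derivable S x 1) ->
  {within `[c, d], continuous (derive1 S)} ->
  (forall x, c < x < d -> 0 < derive1 S x) ->
  forall E, measurable E -> E `<=` `]S c, S d[ ->
    mu E = (\int[mu]_(x in `]c, d[ `&` S @^-1` E) (derive1 S x)%:E)%E.
Proof.
move=> cd dS cS' S'0.
have cS : {within `[c, d], continuous S}.
  apply: derivable_within_continuous => x; rewrite in_itv/= => xcd; exact: dS.
have Sinc x y : c <= x -> x < y -> y <= d -> S x < S y.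
  move=> cx xy yd; have df z : z \in `]c, d[ -> derivable S z 1.
    by move=> /[!in_itv]/= /andP[/ltW ? /ltW ?]; apply: dS; apply/andP.
  have df0 z : z \in `]c, d[ -> 0 < derive1 S z.
    by move=> /[!in_itv]/= ?; exact: S'0.
  apply: (gtr0_derive1_lt_cc df df0 cS) => //; rewrite in_itv/=.
    by rewrite cx (le_trans (ltW xy)).
  by rewrite yd andbT (le_trans cx (ltW xy)).
have Scd : S c < S d by exact: Sinc.
set U : set R := `]c, d[%classic; set V : set R := `]S c, S d[%classic.
have mU : measurable U by exact: measurable_itv.
have mV : measurable V by exact: measurable_itv.
have SUV x : U x -> V (S x).
  rewrite /U /V/= !in_itv/= => /andP[cx xd].
  by rewrite !Sinc ?lexx// ltW.
have mS : measurable_fun U S.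
  apply: subspace_continuous_measurable_fun => //.
  by apply: continuous_subspaceW cS; exact: subset_itv_oo_cc.
have mS' : measurable_fun U (derive1 S).
  apply: subspace_continuous_measurable_fun => //.
  by apply: continuous_subspaceW cS'; exact: subset_itv_oo_cc.
have S'ge0 x : U x -> 0 <= derive1 S x.
  by rewrite /U/= in_itv/= => /S'0 /ltW.
pose nu2 := fun E : set (measurableTypeR R) =>
  (\int[mu]_(x in U `&` S @^-1` E) (derive1 S x)%:E)%E.
have nu20 : nu2 set0 = 0%E by rewrite /nu2 preimage_set0 setI0 integral_set0.
have nu2ge0 E : (0 <= nu2 E)%E.
  by apply: integral_ge0 => x [Ux _]; rewrite lee_fin S'ge0.
have nu2sigma : semi_sigma_additive nu2.
  exact: (@image_density_sigma_additive _ _ (measurableTypeR R) (measurableTypeR R)).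
pose nu2_mixin := isMeasure.Build _ (measurableTypeR R) R nu2 nu20 nu2ge0 nu2sigma.
pose nu2m : {measure set (measurableTypeR R) -> \bar R} := HB.pack nu2 nu2_mixin.
(* Uniqueness speaks of measures on the whole line: Lebesgue measure off [V] completes the image
   measure [nu2], which charges only [V]. *)
pose nu := measure_add (mrestr mu (measurableC mV)) nu2m.
have key : forall X, ocitv X -> mu X = nu X.
  move=> _ [[y1 y2] _ <-] /=; set X : set R := `]y1, y2]%classic.
  have mX : measurable X by exact: measurable_itv.
  rewrite /nu measure_addE.
  have -> : mu X = (mu (X `\` V) + mu (X `&` V))%E by exact: measureDI.
  congr (_ + _)%E.
  change (mu (X `&` V) = nu2 X).
  have [y12|y21] := ltP y1 y2; last first.
    have -> : X = set0.
      apply/seteqP; split => // x; rewrite /X/= in_itv/= => /andP[h1 h2].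
      by have := lt_le_trans h1 (le_trans h2 y21); rewrite ltxx.
    by rewrite set0I measure0 nu20.
  pose u1 := clip (S c) (S d) y1; pose u2 := clip (S c) (S d) y2.
  have u12 : u1 <= u2 by exact/clip_le/ltW.
  have /andP[cu1 u1d] : S c <= u1 <= S d by exact: clip_bounds.
  have /andP[cu2 u2d] : S c <= u2 <= S d by exact: clip_bounds.
  have ivt u : S c <= u -> u <= S d -> exists2 s, s \in `[c, d] & S s = u.
    move=> h1 h2; apply: IVT => //; first exact: ltW.
    by rewrite minEle maxEle (ltW Scd) h1.
  have [s scd Ss] := ivt _ cu1 u1d; have [t tcd St] := ivt _ cu2 u2d.
  move: scd tcd; rewrite !in_itv/= => /andP[cs sd] /andP[ct td].
  have st : s <= t.
    rewrite leNgt; apply/negP => ts; have := Sinc _ _ ct ts sd.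
    by rewrite Ss St ltNge u12.
  have XV v : V v -> X v <-> (u1 < v <= u2).
    rewrite /V/= in_itv/= => vV; rewrite /X/= in_itv/=.
    by rewrite !leNgt !clip_lt.
  (* Truncation by [clip] may push the right end out of [V]; deleting the null points [u2] and [t]
     makes both sets open intervals in all cases. *)
  have E1 : (X `&` V) `\ u2 = `]u1, u2[%classic.
    apply/seteqP; split => v /=.
      move=> [[Xv Vv] vu2]; have /andP[h1 h2] := (XV _ Vv).1 Xv.
      by rewrite in_itv/= h1 lt_neqAle h2 andbT; exact/eqP.
    rewrite in_itv/= => /andP[h1 h2].
    have Vv : V v by rewrite /V/= in_itv/= (le_lt_trans cu1 h1) (lt_le_trans h2).
    split; last by move=> vu2; rewrite vu2 ltxx in h2.
    by split => //; apply/(XV _ Vv); rewrite h1 ltW.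
  have E2 : (U `&` S @^-1` X) `\ t = `]s, t[%classic.
    apply/seteqP; split => x /=.
      move=> [[Ux Xx] xt]; have /andP[h1 h2] := (XV _ (SUV _ Ux)).1 Xx.
      move: Ux; rewrite /U/= !in_itv/= => /andP[cx xd].
      apply/andP; split.
        rewrite ltNge; apply/negP; rewrite le_eqVlt => /predU1P[xs|xs].
          by move: h1; rewrite xs Ss ltxx.
        by have := Sinc _ _ (ltW cx) xs sd; rewrite Ss ltNge (ltW h1).
      rewrite ltNge; apply/negP; rewrite le_eqVlt => /predU1P[tx|tx].
        exact: xt.
      by have := Sinc _ _ ct tx (ltW xd); rewrite St ltNge h2.
    rewrite in_itv/= => /andP[sx xt].
    have Ux : U x by rewrite /U/= in_itv/= (le_lt_trans cs) ?(lt_le_trans xt).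
    split; last by move=> E; rewrite E ltxx in xt.
    split => //; apply/(XV _ (SUV _ Ux)); rewrite -Ss -St.
    rewrite Sinc//=; first by rewrite ltW// Sinc// (le_trans cs)// ltW.
    by rewrite (le_trans (ltW xt)).
  rewrite -(@lebesgue_measureD1 _ u2); last exact: measurableI.
  rewrite E1 /nu2 -(@integral_setD1 _ _ t) ?E2; last 2 first.
  - exact: measurable_itv.
  - apply/measurable_EFinP; apply: measurable_funS mS' => // x.
    rewrite /U/= !in_itv/= => /andP[? ?].
    by rewrite (le_lt_trans cs)// (lt_le_trans _ td).
  rewrite lebesgue_measure_itv/= lte_fin.
  case: ltP => [ltu|geu]; last first.
    have st' : t <= s.
      rewrite leNgt; apply/negP => lst; have := Sinc _ _ cs lst td.
      by rewrite Ss St ltNge geu.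
    rewrite (_ : `]s, t[%classic = set0) ?integral_set0//.
    apply/seteqP; split => // x /=; rewrite in_itv/= => /andP[h1 h2].
    by have := lt_trans h1 h2; rewrite ltNge st'.
  have lst : s < t.
    by rewrite lt_neqAle st andbT; apply/eqP => E; move: ltu; rewrite -Ss -St E ltxx.
  rewrite -(@integral_itv_bndoo _ s t _ true false); last first.
    apply/measurable_EFinP; apply: measurable_funS mS' => // x.
    rewrite /U/= !in_itv/= => /andP[? ?].
    by rewrite (le_lt_trans cs)// (lt_le_trans _ td).
  rewrite (@continuous_FTC2 _ (derive1 S) S)//.
  - by rewrite Ss St.
  - apply: continuous_subspaceW cS' => x /=.
    rewrite !in_itv/= => /andP[? ?].
    by rewrite (le_trans cs)//= (le_trans _ td).
  - have cSx x : c <= x <= d -> {for x, continuous S}.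
      by move=> /dS ?; exact/differentiable_continuous/derivable1_diffP.
    split.
    + move=> x; rewrite in_itv/= => /andP[/ltW ? /ltW ?]; apply: dS.
      by rewrite (le_trans cs)//= (le_trans _ td).
    + by apply: cvg_at_right_filter; apply: cSx; rewrite cs.
    + by apply: cvg_at_left_filter; apply: cSx; rewrite ct.
move=> E mE EV.
have -> : mu E = nu E by exact: (lebesgue_measure_unique key).
rewrite /nu measure_addE.
rewrite -[RHS]add0e; congr (_ + _)%E.
change (mu (E `&` ~` V) = 0%E).
by rewrite -setDE (_ : E `\` V = set0) ?measure0// setD_eq0.
Qed.

End change_of_variables.

(** * Inverse branches of one map: contraction, weight and distortion *)

Section monotone_piece.
Context {R : realType}.
Local Notation mu := (@lebesgue_measure R).

Lemma lipschitz_within_continuous (D : set R) (f : R -> R) (L : R) :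
  (forall x y, D x -> D y -> `|f x - f y| <= L * `|x - y|) ->
  {within D, continuous f}.
Proof.
move=> fL; apply/subspace_continuousP => x Dx.
apply/cvgrPdist_lt => e e0.
pose L1 := `|L| + 1; have L10 : 0 < L1 by rewrite ltr_wpDl.
rewrite near_withinE; near=> t => Dt.
apply: le_lt_trans (fL _ _ Dx Dt) _.
have xt : `|x - t| < e / L1.
  by near: t; apply: nbhsx_ballx; rewrite divr_gt0.
apply: (@le_lt_trans _ _ (L1 * `|x - t|)).
  by rewrite ler_wpM2r// (le_trans (ler_norm _))// lerDl.
by rewrite mulrC -ltr_pdivlMr.
Unshelve. all: by end_near. Qed.

Lemma lipschitz_measurable (D : set R) (f : R -> R) (L : R) : measurable D ->
  (forall x y, D x -> D y -> `|f x - f y| <= L * `|x - y|) ->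
  measurable_fun D f.
Proof.
move=> mD fL; apply: subspace_continuous_measurable_fun => //.
exact: lipschitz_within_continuous fL.
Qed.

Lemma is_intervalI (A B : set R) :
  is_interval A -> is_interval B -> is_interval (A `&` B).
Proof.
by move=> iA iB x y [Ax Bx] [Ay By] z xzy; split; [exact: iA xzy|exact: iB xzy].
Qed.

Lemma MVT_oo (f : R -> R) (c d x y : R) :
  (forall z, c < z < d -> derivable f z 1) -> c < x < d -> c < y < d ->
  exists2 z, c < z < d & f x - f y = derive1 f z * (x - y).
Proof.
move=> df.
have lt_case (a b : R) : a < b -> c < a < d -> c < b < d ->
    exists2 z, c < z < d & f b - f a = derive1 f z * (b - a).
  move=> ab /andP[ca ad] /andP[cb bd].
  have abcd z : a <= z <= b -> c < z < d.
    by move=> /andP[az zb]; rewrite (lt_le_trans ca)// (le_lt_trans zb).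
  have [||z zab ->] := @MVT R f (derive1 f) a b ab.
  - move=> z /[!in_itv]/= /andP[/ltW az /ltW zb].
    rewrite derive1E; apply/derivableP/df/abcd; exact/andP.
  - by apply: derivable_within_continuous => z /[!in_itv]/= ?; exact/df/abcd.
  exists z => //; apply: abcd; move: zab; rewrite in_itv/= => /andP[? ?].
  by rewrite !ltW.
move=> xcd ycd; have [xy|yx|->] := ltgtP x y.
- have [z zcd fxy] := lt_case _ _ xy xcd ycd; exists z => //.
  by rewrite -(opprB (f y)) fxy -mulrN opprB.
- exact: lt_case.
- by exists y => //; rewrite !subrr mulr0.
Qed.

(** [tau] is the inverse branch of [T] from [K] to [U], and [w] stands for |tau'| = 1/|T'(tau)|.
    [mp_image] keeps from monotonicity only that intervals pull back to intervals; [mp_distortion]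
    is a Lipschitz bound on log w. *)
Record monotone_piece (T : R -> R) (la M : R) (U K : set R) (tau w : R -> R) :
    Prop := {
  mp_openU : open U;
  mp_itvU : is_interval U;
  mp_openK : open K;
  mp_inv : forall y, K y -> U (tau y) /\ T (tau y) = y;
  mp_map : forall x, U x -> K (T x) /\ tau (T x) = x;
  mp_measurable_map : measurable_fun U T;
  mp_lip : forall y y', K y -> K y' -> `|tau y - tau y'| <= la^-1 * `|y - y'|;
  mp_wt : forall y, K y -> 0 < w y <= la^-1;
  mp_distortion : forall y y', K y -> K y' ->
    w y <= w y' * expR (M / la * `|y - y'|);
  mp_measurable_wt : measurable_fun K w;
  mp_image : forall D, is_interval D -> is_interval (K `&` tau @^-1` D);
  mp_change_var : forall Q : R -> \bar R, measurable_fun U Q ->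
    (forall x, U x -> 0 <= Q x)%E ->
    (\int[mu]_(x in U) Q x = \int[mu]_(y in K) (Q (tau y) * (w y)%:E))%E }.

(** Fills the labels in ['I_N] that carry no piece, or a piece with empty interior. *)
Lemma monotone_piece_set0 T la M : monotone_piece T la M set0 set0 id (cst 1).
Proof.
split => //; rewrite ?set0I; try exact: open0; try exact: measurable_fun_set0.
- by move=> D _; rewrite set0I.
- by move=> Q _ _; rewrite !integral_set0.
Qed.

Lemma constant_sign (f : R -> R) (c d : R) : c < d ->
  (forall x, c < x < d -> {for x, continuous f}) ->
  (forall x, c < x < d -> f x != 0) ->
  exists2 s : R, s = 1 \/ s = -1 & forall x, c < x < d -> f x = s * `|f x|.
Proof.
move=> cd cf f0.
pose m := (c + d) / 2.
have mcd : c < m < d by rewrite !midf_lt.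
have same_sign (a b : R) : a <= b -> c < a < d -> c < b < d -> 0 < f a * f b.
  move=> ab /[dup] acd /andP[ca ad] /[dup] bcd /andP[cb bd].
  have fafb : f a * f b != 0 by rewrite mulf_neq0 ?f0.
  rewrite lt_neqAle eq_sym fafb/= leNgt; apply/negP => neg.
  have ab_cd z : a <= z <= b -> c < z < d.
    by move=> /andP[az zb]; rewrite (lt_le_trans ca)//= (le_lt_trans zb).
  have [||z zab z0] := @IVT R f a b 0 ab.
  - apply: continuous_in_subspaceT => z /set_mem.
    by rewrite /= in_itv/= => /ab_cd; exact: cf.
  - rewrite ge_min le_max.
    by case: (lerP (f a) 0) => fa; case: (lerP (f b) 0) => fb /=; nra.
  by move: zab; rewrite in_itv/= => /ab_cd /f0; rewrite z0 eqxx.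
have fm x : c < x < d -> 0 < f m * f x.
  move=> xcd; have [mx|/ltW xm] := leP m x; first exact: same_sign.
  by rewrite mulrC; exact: same_sign.
have := f0 _ mcd; rewrite neq_lt => /orP[fm0|fm0].
- exists (-1); first by right.
  move=> x /fm; rewrite nmulr_rgt0// => fx0.
  by rewrite ltr0_norm// mulN1r opprK.
- exists 1; first by left.
  by move=> x /fm; rewrite pmulr_rgt0// => fx0; rewrite gtr0_norm// mul1r.
Qed.

(** With s the constant sign of S', the map s S is increasing, and Lebesgue measure is invariant
    under reflection. *)
Lemma image_density (c d : R) (S : R -> R) : c < d ->
  (forall x, c <= x <= d -> derivable S x 1) ->
  (forall x, c <= x <= d -> {for x, continuous (derive1 S)}) ->
  (forall x, c < x < d -> derive1 S x != 0) ->
  [/\ open (S @` `]c, d[), is_interval (S @` `]c, d[) &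
  forall E, measurable E -> E `<=` S @` `]c, d[ ->
    mu E = (\int[mu]_(x in `]c, d[ `&` S @^-1` E) (`|derive1 S x|)%:E)%E].
Proof.
move=> cd dS cS' S'0.
have oo_cc x : c < x < d -> c <= x <= d by move=> /andP[? ?]; rewrite !ltW.
have [s s1 sS'] : exists2 s : R, s = 1 \/ s = -1 &
    forall x, c < x < d -> derive1 S x = s * `|derive1 S x|.
  by apply: constant_sign => // x /oo_cc; exact: cS'.
have ss : s * s = 1 by case: s1 => ->; rewrite ?mulr1 ?mulrNN ?mulr1.
pose F x := s * S x.
have dF x : c <= x <= d -> is_derive x 1 F (s * derive1 S x).
  move=> /dS Sx; rewrite derive1E.
  have -> : F = s *: S by [].
  by apply: is_deriveZ; exact/derivableP.
have F'E x : c <= x <= d -> derive1 F x = s * derive1 S x.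
  by move=> /dF dFx; rewrite derive1E; exact: derive_val.
have cF' : {within `[c, d], continuous (derive1 F)}.
  have : {within `[c, d], continuous (fun x => s * derive1 S x)}.
    apply: continuous_in_subspaceT => x /set_mem; rewrite /= in_itv/= => xcd.
    by apply: continuousM; [exact: cst_continuous|exact: cS'].
  apply: subspace_eq_continuous => x /set_mem; rewrite /= in_itv/= => xcd.
  apply/esym; exact: F'E.
have dF1 x : c <= x <= d -> derivable F x 1.
  by move=> /dF dFx; exact: ex_derive.
have F'0 x : c < x < d -> 0 < derive1 F x.
  move=> xcd; rewrite F'E; last exact: oo_cc.
  by rewrite sS'// mulrA ss mul1r normr_gt0 S'0.
have density := increasing_image_density cd dF1 cF' F'0.
have cF : {within `[c, d], continuous F}.
  by apply: derivable_within_continuous => x; rewrite in_itv/=; exact: dF1.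
have Finc : {in `[c, d] &, {homo F : x y / x < y}}.
  apply: gtr0_derive1_lt_cc cF => x; rewrite in_itv/=.
    by move=> /oo_cc; exact: dF1.
  exact: F'0.
have Fcd : F c < F d by apply: Finc => //; rewrite in_itv/= lexx ltW.
have imF : S @` `]c, d[ = [set y | F c < s * y < F d].
  apply/seteqP; split => [_ [x + <-]|y /= /andP[y1 y2]].
    move=> xcd; have := @increasing_image_oo R F c d cd Finc (F x).
    by rewrite /= in_itv/=; apply; exists x.
  have [|x xcd Fx] := @IVT R F c d (s * y) (ltW cd) cF.
    by rewrite minEle maxEle (ltW Fcd) !ltW.
  have Sxy : S x = y by rewrite -[S x]mul1r -ss -mulrA -/(F x) Fx mulrA ss mul1r.
  exists x => //; move: xcd; rewrite !in_itv/= => /andP[cx xd].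
  rewrite !lt_neqAle cx xd !andbT; apply/andP; split.
    by apply/eqP => E; move: y1; rewrite -Fx E ltxx.
  by apply/eqP => E; move: y2; rewrite -Fx E ltxx.
have imFE : S @` `]c, d[ = `](Num.min (S c) (S d)), (Num.max (S c) (S d))[%classic.
  rewrite imF /F; case: s1 Fcd => E; rewrite /F E ?mul1r ?mulN1r => h.
    by rewrite minEle maxEle (ltW h); apply/seteqP; split => y /=;
       rewrite in_itv/= !mul1r.
  move: h; rewrite ltrN2 => h; rewrite minC maxC minEle maxEle (ltW h).
  by apply/seteqP; split => y /=; rewrite in_itv/= !mulN1r !ltrN2 andbC.
split.
- by rewrite imFE; exact: itv_open.
- by rewrite imFE; exact: interval_is_interval.
move=> E mE EV.
pose E' := [set z | E (s * z)].
have mE'E : measurable E' /\ mu E' = mu E.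
  rewrite /E'; case: s1 => ->.
    have -> : [set z | E (1 * z)] = E.
      by apply/seteqP; split => z /=; rewrite mul1r.
    by [].
  have -> : [set z | E (-1 * z)] = -%R @^-1` E.
    by apply/seteqP; split => z /=; rewrite mulN1r.
  split; last exact: lebesgue_measureN.
  by rewrite -[X in measurable X]setTI; exact: oppr_measurable.
have [mE' <-] := mE'E.
rewrite density//; last first.
  move=> z /EV; rewrite imF/= in_itv/=.
  by rewrite mulrA ss mul1r.
have -> : F @^-1` E' = S @^-1` E.
  by apply/seteqP; split => x; rewrite /E' /F/= mulrA ss mul1r.
apply: eq_integral => x /set_mem[/= xcd _]; move: xcd; rewrite in_itv/= => xcd.
rewrite F'E; last exact: oo_cc.
by rewrite [in LHS]sS'// mulrA ss mul1r.
Qed.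

(** Smoothness is asked up to the closed interval for the fundamental theorem of calculus, while the
    bounds on S' and S'' are available only inside. Distortion comes from the mean value theorem for
    S' and 1 + v <= exp v. *)
Lemma smooth_monotone_piece (T S : R -> R) (la M c d : R) :
  1 < la -> c < d -> {in `]c, d[, T =1 S} ->
  (forall x, c <= x <= d -> derivable S x 1) ->
  (forall x, c <= x <= d -> derivable (derive1 S) x 1) ->
  (forall x, c < x < d -> la <= `|derive1 S x|) ->
  (forall x, c < x < d -> `|derive1 (derive1 S) x| <= M) ->
  exists K tau w, monotone_piece T la M `]c, d[ K tau w.
Proof.
move=> la1 cd TS dS ddS laS MS.
have la0 : 0 < la by exact: lt_trans la1.
have lai : la^-1 <= 1 by rewrite invf_le1// ltW.
have M0 : 0 <= M.
  have : c < (c + d) / 2 < d by rewrite !midf_lt.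
  by move/MS; exact: le_trans.
have oo_cc x : c < x < d -> c <= x <= d by move=> /andP[? ?]; rewrite !ltW.
have cS' x : c <= x <= d -> {for x, continuous (derive1 S)}.
  by move=> /ddS ?; exact/differentiable_continuous/derivable1_diffP.
have S'neq0 x : c < x < d -> derive1 S x != 0.
  by move=> /laS; apply: contraTneq => ->; rewrite normr0 -ltNge.
have [oK iK density] := image_density cd dS cS' S'neq0.
set U : set R := `]c, d[%classic in oK iK density *.
set K := S @` U in oK iK density.
have UE x : U x = (c < x < d) :> Prop by rewrite /U/= in_itv.
have expand x y : U x -> U y -> la * `|x - y| <= `|S x - S y|.
  rewrite !UE => Ux Uy.
  have [|z zcd ->] := @MVT_oo S c d x y _ Ux Uy.
    by move=> z /oo_cc; exact: dS.
  by rewrite normrM ler_wpM2r// laS.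
have Sinj x y : U x -> U y -> S x = S y -> x = y.
  move=> Ux Uy Sxy; have := expand _ _ Ux Uy.
  rewrite Sxy subrr normr0 pmulr_rle0// normr_le0 subr_eq0.
  by move=> /eqP.
pose tau y := xget c [set x | U x /\ S x = y].
have tauP y : K y -> U (tau y) /\ S (tau y) = y.
  move=> [x Ux Sxy]; rewrite /tau; case: xgetP => [z _ //|/(_ x)].
  by move=> []; split.
pose w y := `|derive1 S (tau y)|^-1.
have KS x : U x -> K (S x) /\ tau (S x) = x.
  move=> Ux; have KSx : K (S x) by exists x.
  by split => //; have [Ut St] := tauP _ KSx; exact: Sinj.
have tau_lip y y' : K y -> K y' -> `|tau y - tau y'| <= la^-1 * `|y - y'|.
  move=> /tauP[Uy Sy] /tauP[Uy' Sy'].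
  by rewrite ler_pdivlMl// (le_trans (expand _ _ Uy Uy'))// Sy Sy'.
have mK : measurable K by exact: is_interval_measurable.
have mU : measurable U by exact: measurable_itv.
have mtau : measurable_fun K tau by exact: lipschitz_measurable tau_lip.
have tauU : tau @` K `<=` U by move=> _ [y /tauP[Uy _] <-].
have cS : {within U, continuous S}.
  apply: derivable_within_continuous => x; rewrite in_itv/= => /oo_cc; exact: dS.
have mS : measurable_fun U S by exact: subspace_continuous_measurable_fun.
have mS' : measurable_fun U (fun x => `|derive1 S x|).
  apply: measurableT_comp => //; apply: subspace_continuous_measurable_fun => //.
  apply: continuous_in_subspaceT => x /set_mem.
  by rewrite UE => /oo_cc; exact: cS'.
have S'w x : U x -> `|derive1 S x| > 0 by rewrite UE => /S'neq0; rewrite normr_gt0.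
have mw : measurable_fun K w.
  have : measurable_fun U (fun x => `|derive1 S x|^-1).
    apply: open_continuous_measurable_fun; first exact: itv_open.
    move=> x /set_mem; rewrite UE => Ux.
    apply: cvgV; first by rewrite normr_eq0 S'neq0.
    by apply: cvg_norm; exact/cS'/oo_cc.
  by move=> mi; exact: (measurable_comp mU tauU mi mtau).
exists K, tau, w; split => //.
- exact: interval_is_interval.
- move=> y Ky; have [Uy Sy] := tauP _ Ky; split=> //.
  by rewrite TS ?Sy// inE.
- by move=> x Ux; rewrite TS ?inE//; exact: KS.
- by apply: eq_measurable_fun mS => x /set_mem Ux; rewrite TS.
- move=> y /tauP[]; rewrite UE => Uy _; rewrite /w invr_gt0 normr_gt0 S'neq0//=.
  by rewrite lef_pV2 ?posrE ?normr_gt0 ?S'neq0// laS.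
- move=> y y' Ky Ky'; have [Uy _] := tauP _ Ky; have [Uy' _] := tauP _ Ky'.
  rewrite /w ler_pdivlMl ?S'w// ler_pdivrMr ?S'w// mulrC.
  move: (Uy) (Uy'); rewrite !UE => Uy1 Uy'1.
  have [|z zcd D'] := @MVT_oo (derive1 S) c d (tau y') (tau y) _ Uy'1 Uy1.
    by move=> z /oo_cc; exact: ddS.
  (* The mean value theorem gives M/la; this 1/la is dropped, since dividing by |S'| >= la below
     provides the one kept in [mp_distortion]. *)
  have : `|derive1 S (tau y')| - `|derive1 S (tau y)| <= M * `|y - y'|.
    apply: le_trans (lerB_dist _ _) _.
    rewrite D' normrM (distrC (tau y')); apply: ler_pM => //; first exact: MS.
    rewrite (le_trans (tau_lip _ _ Ky Ky'))// ler_piMl//.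
  rewrite lerBlDr => /le_trans; apply.
  apply: (@le_trans _ _ (`|derive1 S (tau y)| * (1 + M / la * `|y - y'|))).
    rewrite mulrDr mulr1 addrC lerD2l mulrA ler_wpM2r// mulrA.
    by rewrite ler_pdivlMr// [leRHS]mulrC ler_wpM2l// laS.
  by rewrite ler_wpM2l// expR_ge1Dx.
- move=> D iD; have -> : K `&` tau @^-1` D = S @` (U `&` D).
    apply/seteqP; split => [y [Ky Dy]|_ [x [Ux Dx] <-]].
      by have [Uy Sy] := tauP _ Ky; exists (tau y).
    by have [? E] := KS _ Ux; split => //=; rewrite E.
  apply/connected_intervalP/connected_continuous_connected.
    by apply/connected_intervalP; apply: is_intervalI iD; exact: interval_is_interval.
  by apply: continuous_subspaceW cS => x [].
- move=> Q mQ Q0.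
  rewrite (@ge0_integral_image_density _ _ _ _ _ mu mu U K S
             (fun x => `|derive1 S x|))//.
  + apply: eq_integral => x /set_mem Ux; have [_ ->] := KS _ Ux.
    rewrite -muleA -EFinM /w; have [_ ->] := KS _ Ux.
    by rewrite mulVf ?mule1// gt_eqF// S'w.
  + apply: emeasurable_funM; last exact/measurable_EFinP.
    exact: (measurable_comp mU tauU mQ mtau).
  + move=> y /tauP[Uy _]; rewrite mule_ge0 ?Q0// lee_fin invr_ge0//.
Qed.

End monotone_piece.

(** * Inverse branches of the iterates *)

Section expanding_system.
Context {R : realType}.
Local Notation mu := (@lebesgue_measure R).

Lemma closure_oo (c d x : R) : c < d -> c <= x <= d -> closure `]c, d[ x.
Proof.
move=> cd /andP[cx xd] B /nbhs_ballP[e /= e0 eB].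
pose m := (c + d) / 2.
have : c < m < d by rewrite !midf_lt.
move=> /andP[cm md].
have [xm|mx] := leP x m.
- pose t := Num.min (e / 2) ((d - m) / 2).
  have t0 : 0 < t by rewrite lt_min !divr_gt0// subr_gt0.
  have te : t <= e / 2 by rewrite ge_min lexx.
  have td : t <= (d - m) / 2 by rewrite ge_min lexx orbT.
  exists (x + t); split; first by rewrite /= in_itv/=; apply/andP; split; lra.
  by apply: eB; rewrite /ball/= opprD addrA subrr sub0r normrN gtr0_norm//; lra.
- pose t := Num.min (e / 2) ((m - c) / 2).
  have t0 : 0 < t by rewrite lt_min !divr_gt0// subr_gt0.
  have te : t <= e / 2 by rewrite ge_min lexx.
  have td : t <= (m - c) / 2 by rewrite ge_min lexx orbT.
  exists (x - t); split; first by rewrite /= in_itv/=; apply/andP; split; lra.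
  by apply: eB; rewrite /ball/= opprD addrA subrr sub0r opprK gtr0_norm//; lra.
Qed.

(** All maps share the label type ['I_N], some [U p] being possibly empty, so that N alone measures
    the number of cuts. The points outside the pieces are countable, hence null. *)
Record expanding_system (T : R -> R) (la M : R) (N : nat)
    (U K : 'I_N -> set R) (tau w : 'I_N -> R -> R) : Prop := {
  es_piece : forall p, monotone_piece T la M (U p) (K p) (tau p) (w p);
  es_subU : forall p, U p `<=` @I01 R;
  es_subK : forall p, K p `<=` @I01 R;
  es_disjoint : trivIset setT U;
  es_cover : countable (@I01 R `\` \bigcup_p U p) }.

Lemma derive1_near (f g : R -> R) (U : set R) x : open U -> U x ->
  (forall y, U y -> f y = g y) -> derive1 f x = derive1 g x.
Proof.
move=> oU Ux fg; rewrite !derive1E; apply: near_eq_derive.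
by near=> y; apply: fg; near: y; exact: open_nbhs_nbhs.
Unshelve. all: by end_near. Qed.

Lemma bounded_interval_interior (J : set R) : is_interval J -> J `<=` @I01 R ->
  J° !=set0 -> exists c d, [/\ c < d, J° = `]c, d[%classic &
    forall x, J x -> J° x \/ (x = c \/ x = d)].
Proof.
move=> iJ J01 [z Jz].
have lbJ : has_lbound J by exists 0 => x /J01; rewrite /I01/= in_itv/= => /andP[].
have ubJ : has_ubound J by exists 1 => x /J01; rewrite /I01/= in_itv/= => /andP[].
have JE := interval_bounded_interior iJ lbJ ubJ.
exists (inf J), (sup J); split.
- by move: Jz; rewrite JE /= => /andP[]; exact: lt_trans.
- by rewrite JE; apply/seteqP; split => x /=; rewrite in_itv.
- move=> x Jx; rewrite JE/=.
  have h1 : inf J <= x by exact: ge_inf.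
  have h2 : x <= sup J by exact: ub_le_sup.
  have [->|xi] := eqVneq x (inf J); first by right; left.
  have [->|xs] := eqVneq x (sup J); first by right; right.
  by left; rewrite !lt_neqAle h1 h2 xs eq_sym xi.
Qed.

(** On the open set J° the map T and its C^2 extension S have the same first two derivatives, so the
    bounds pass to S; regularity up to the end points comes from S. *)
Lemma branch_monotone_piece (T : R -> R) (P : set (set R)) (la M : R) J :
  1 < la -> piecewise_expanding T P -> (la%:E <= inf_abs_deriv T P)%E ->
  (sup_abs_deriv2 T P <= M%:E)%E -> P J -> J° !=set0 ->
  exists K tau w, monotone_piece T la M J° K tau w.
Proof.
move=> la1 [T01 [finP covP iP trP] extP _] laT MT PJ J0.
have J01 : J `<=` @I01 R by rewrite -covP => x Jx; exists J.
have [c [d [cd JE _]]] := bounded_interval_interior (iP _ PJ).2 J01 J0.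
have [V [S [oV JV C2S TS]]] := extP _ PJ.
have JS x : J° x -> T x = S x by exact: TS.
have oJ : open J° by exact: open_interior.
have ccV x : c <= x <= d -> V x.
  move=> xcd; apply: JV.
  apply: (closureS (@interior_subset _ J)); rewrite JE; exact: closure_oo.
have J'S x : J° x -> derive1 T x = derive1 S x.
  by move=> Jx; exact: (derive1_near oJ Jx).
have J''S x : J° x -> derive1 (derive1 T) x = derive1 (derive1 S) x.
  by move=> Jx; apply: (derive1_near oJ Jx).
have inJ x : c < x < d -> J° x by rewrite JE /= in_itv.
have inner x : J° x -> inner_points P x by move=> Jx; exists J.
rewrite JE; apply: (@smooth_monotone_piece R T S) => //.
- by move=> x; rewrite in_itv/= => /inJ /JS.
- by move=> x /ccV /C2S[].
- by move=> x /ccV /C2S[].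
- move=> x /inJ Jx; rewrite -J'S// -lee_fin (le_trans laT)//.
  by apply: ereal_inf_lbound; exists x => //; exact: inner.
- move=> x /inJ Jx; rewrite -J''S// -lee_fin (le_trans _ MT)//.
  by apply: ereal_sup_ubound; exists x => //; exact: inner.
Qed.

Lemma expanding_system_exists (T : R -> R) (P : set (set R)) (la M : R) N :
  1 < la -> piecewise_expanding T P -> (la%:E <= inf_abs_deriv T P)%E ->
  (sup_abs_deriv2 T P <= M%:E)%E -> P #<= `I_N ->
  exists U K tau w, @expanding_system T la M N U K tau w.
Proof.
move=> la1 PT laT MT /pcard_leP[h].
have [f fN finj] : exists2 f : set R -> nat, forall J, P J -> (f J < N)%N &
    {in P &, injective f}.
  by exists h; [move=> J PJ; exact: (@funS _ _ _ _ h)|exact: (@inj _ _ _ h)].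
have [T01 [finP covP iP trP] extP _] := PT.
pose U (p : 'I_N) := [set x | exists J, [/\ P J, f J = p & J° x]].
have J01 J : P J -> J `<=` @I01 R by move=> PJ; rewrite -covP => x Jx; exists J.
have UJ (p : 'I_N) J : P J -> f J = p -> U p = J°.
  move=> PJ fJ; apply/seteqP; split => x; last by exists J.
  move=> [J' [PJ' fJ' Jx]]; suff -> : J = J' by [].
  by apply: finj; rewrite ?inE// fJ fJ'.
have pieces (p : 'I_N) : exists Ktw : set R * ((R -> R) * (R -> R)),
    monotone_piece T la M (U p) Ktw.1 Ktw.2.1 Ktw.2.2.
  have [[x [J [PJ fJ Jx]]]|U0] := pselect (U p !=set0); last first.
    have -> : U p = set0 by apply/eqP; rewrite -(negbK (U p == set0)); apply/negP => /set0P.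
    by exists (set0, (id, cst 1)); exact: monotone_piece_set0.
  rewrite (UJ _ _ PJ fJ).
  have [K [tau [w H]]] := branch_monotone_piece la1 PT laT MT PJ (ex_intro _ x Jx).
  by exists (K, (tau, w)).
have [F FP] := choice pieces.
exists U, (fun p => (F p).1), (fun p => (F p).2.1), (fun p => (F p).2.2).
have U01 p : U p `<=` @I01 R.
  by move=> x [J [PJ _ /interior_subset]]; exact: J01.
split=> //.
- move=> p y Ky; have [/U01 Uy <-] := mp_inv (FP p) Ky.
  exact: T01.
- move=> p q _ _ [x [[J [PJ fJ Jx]] [J' [PJ' fJ' J'x]]]].
  apply/val_inj; rewrite /= -fJ -fJ'; congr (f _).
  by apply: trP => //; exists x.
(* A point of [0, 1] outside all interiors is an end point inf J or sup J of the piece J containing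
   it. *)
- apply: finite_set_countable.
  apply: (@sub_finite_set _ _ (inf @` P `|` sup @` P)).
    move=> x [x01 Ux]; move: (x01); rewrite -covP => -[J PJ Jx].
    have lbJ : has_lbound J by exists 0 => y /(J01 _ PJ); rewrite /I01/= in_itv/= => /andP[].
    have ubJ : has_ubound J by exists 1 => y /(J01 _ PJ); rewrite /I01/= in_itv/= => /andP[].
    have JE := interval_bounded_interior (iP _ PJ).2 lbJ ubJ.
    have h1 : inf J <= x by exact: ge_inf.
    have h2 : x <= sup J by exact: ub_le_sup.
    have [->|xi] := eqVneq x (inf J); first by left; exists J.
    have [->|xs] := eqVneq x (sup J); first by right; exists J.
    exfalso; apply: Ux.
    exists (Ordinal (fN _ PJ)) => //; exists J; split => //.
    by rewrite JE/= !lt_neqAle h1 h2 xs eq_sym xi.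
  by rewrite finite_setU; split; exact: finite_image.
Qed.

End expanding_system.

Section branches.
Context {R : realType}.
Local Notation mu := (@lebesgue_measure R).

Lemma measurable_I01 : measurable (@I01 R).
Proof. exact: measurable_itv. Qed.

Lemma expanding_system_integral (T : R -> R) (la M : R) (N : nat)
    (U K : 'I_N -> set R) (tau w : 'I_N -> R -> R) (Q : R -> \bar R) :
  expanding_system T la M U K tau w -> measurable_fun (@I01 R) Q ->
  (forall x, I01 x -> 0 <= Q x)%E ->
  (\int[mu]_(x in @I01 R) Q x = \sum_(p < N) \int[mu]_(x in U p) Q x)%E.
Proof.
move=> sys mQ Q0.
have m01 := measurable_I01.
have mU p : measurable (U p) by exact: open_measurable (mp_openU (es_piece sys p)).
have UE : \bigcup_p U p = \big[setU/set0]_(p <- enum 'I_N) U p.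
  rewrite -bigcup_seq; apply/seteqP; split => x [p _ Upx]; exists p => //=.
  by rewrite mem_enum.
have mUU : measurable (\bigcup_p U p).
  by rewrite UE; exact: bigsetU_measurable.
have UU01 : \bigcup_p U p `<=` @I01 R by move=> x [p _]; exact: (es_subU sys).
rewrite (@ge0_negligible_integral _ _ _ mu _ (@I01 R `\` \bigcup_p U p))//; last 2 first.
- exact: measurableD.
- exact/countable_lebesgue_measure0/(es_cover sys).
rewrite setDD (setIidr UU01) UE ge0_integral_bigsetU//.
- by rewrite big_enum.
- exact: enum_uniq.
- exact: sub_trivIset (es_disjoint sys).
- by rewrite -UE; exact: measurable_funS mQ.
- by move=> x; rewrite -UE => /UU01; exact: Q0.
Qed.

(** [br_integral] is the change of variables for S over all inverse branches at once: the ranges of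
    the [inv i] exhaust [0, 1] up to a null set, and the [wt i] are the Jacobians. *)
Record branches (S : R -> R) (I : finType) (D : I -> set R)
    (inv wt : I -> R -> R) : Prop := {
  br_open : forall i, open (D i);
  br_itv : forall i, is_interval (D i);
  br_sub : forall i, D i `<=` @I01 R;
  br_inv : forall i x, D i x -> I01 (inv i x) /\ S (inv i x) = x;
  br_wt : forall i x, D i x -> 0 <= wt i x;
  br_measurable_inv : forall i, measurable_fun (D i) (inv i);
  br_measurable_wt : forall i, measurable_fun (D i) (wt i);
  br_integral : forall Q : R -> \bar R, measurable_fun (@I01 R) Q ->
    (forall x, I01 x -> 0 <= Q x)%E ->
    (\int[mu]_(x in @I01 R) Q x =
     \sum_(i : I) \int[mu]_(x in D i) (Q (inv i x) * (wt i x)%:E))%E }.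

Lemma br_measurable (S : R -> R) (I : finType) (D : I -> set R)
    (inv wt : I -> R -> R) i : branches S D inv wt -> measurable (D i).
Proof. by move=> /br_open Do; exact: open_measurable. Qed.

Lemma branches_id : branches id (fun _ : 'I_1 => `]0, 1[%classic)
  (fun _ => id) (fun _ => cst 1).
Proof.
have D01 : `]0, 1[ `<=` @I01 R by exact: subset_itv_oo_cc.
split => //.
- by move=> _; exact: interval_is_interval.
- by move=> _ x Dx; split => //; exact: D01.
- move=> Q mQ Q0; rewrite big_ord1 /I01 integral_itv_bndoo; last first.
    by apply: measurable_funS mQ => //; exact: measurable_I01.
  by apply: eq_integral => x _; rewrite mule1.
Qed.

(** The branch (i, p) goes back through [tau p], then [inv i], and the weights multiply by the chain
    rule. Pairs with an empty domain are kept, so the index type is the full product. *)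
Lemma branches_comp (S T : R -> R) (I : finType) (D : I -> set R)
    (inv wt : I -> R -> R) (la M : R) (N : nat)
    (U K : 'I_N -> set R) (tau w : 'I_N -> R -> R) :
  branches S D inv wt -> expanding_system T la M U K tau w ->
  branches (T \o S) (fun ip : I * 'I_N => K ip.2 `&` tau ip.2 @^-1` D ip.1)
    (fun ip x => inv ip.1 (tau ip.2 x))
    (fun ip x => wt ip.1 (tau ip.2 x) * w ip.2 x).
Proof.
move=> BS sys; have pc := es_piece sys.
have mD i : measurable (D i) by exact: br_measurable BS.
have mK p : measurable (K p) by exact: open_measurable (mp_openK (pc p)).
have mU p : measurable (U p) by exact: open_measurable (mp_openU (pc p)).
have mtau p : measurable_fun (K p) (tau p).
  by apply: lipschitz_measurable (mp_lip (pc p)).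
have mDD i p : measurable (K p `&` tau p @^-1` D i) by exact: mtau.
have mtauDD i p : measurable_fun (K p `&` tau p @^-1` D i) (tau p).
  by apply: measurable_funS (mtau p) => // x [].
have tauDD i p : tau p @` (K p `&` tau p @^-1` D i) `<=` D i.
  by move=> _ [x [_ Dx] <-].
have mwt i p : measurable_fun (K p `&` tau p @^-1` D i) (fun x => wt i (tau p x)).
  exact: (measurable_comp (mD i) (@tauDD i p) (br_measurable_wt BS (i:=i)) (mtauDD i p)).
split => /=.
- move=> [i p] /=.
  have ctau : {within K p, continuous (tau p)}.
    exact: lipschitz_within_continuous (mp_lip (pc p)).
  rewrite setIC; move: ctau; rewrite continuous_open_subspace; last exact: mp_openK (pc p).
  move=> ctau; rewrite openE => x [Dx Kx].
  apply: filterI; last exact: open_nbhs_nbhs (conj (mp_openK (pc p)) Kx).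
  apply: (ctau x (mem_set Kx)); apply: open_nbhs_nbhs; split => //.
  exact: br_open BS i.
- by move=> [i p]; apply: (mp_image (pc p)); exact: br_itv BS i.
- by move=> [i p] x [Kx _]; exact: (es_subK sys Kx).
- move=> [i p] x [Kx Dx] /=; have [I1 ->] := br_inv BS Dx.
  by split => //; have [] := mp_inv (pc p) Kx.
- move=> [i p] x [Kx Dx] /=; rewrite mulr_ge0 ?(br_wt BS)//.
  by have /andP[/ltW] := mp_wt (pc p) Kx.
- move=> [i p] /=.
  exact: (measurable_comp (mD i) (@tauDD i p) (br_measurable_inv BS (i:=i)) (mtauDD i p)).
- move=> [i p] /=; apply: measurable_funM; first exact: mwt.
  by apply: measurable_funS (mp_measurable_wt (pc p)) => // x [].
move=> Q mQ Q0; rewrite (br_integral BS mQ Q0).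
rewrite -(pair_bigA _ (fun i p => \int[mu]_(x in K p `&` tau p @^-1` D i)
    (Q (inv i (tau p x)) * (wt i (tau p x) * w p x)%:E)))%E /=.
apply: eq_bigr => i _.
pose q x := (Q (inv i x) * (wt i x)%:E)%E.
have q0 x : D i x -> (0 <= q x)%E.
  by move=> Dx; rewrite mule_ge0 ?lee_fin ?(br_wt BS)// Q0//; case: (br_inv BS Dx).
have mq : measurable_fun (D i) q.
  apply: emeasurable_funM; last by apply/measurable_EFinP; exact: (br_measurable_wt BS).
  apply: (measurable_comp measurable_I01 _ mQ (br_measurable_inv BS (i:=i))).
  by move=> _ [x Dx <-]; case: (br_inv BS Dx).
have qD0 x : (0 <= (q \_ (D i)) x)%E.
  by rewrite patchE; case: ifPn => // /set_mem; exact: q0.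
have mqD : measurable_fun setT (q \_ (D i)).
  by apply/(measurable_restrictT _ (mD i)).
transitivity (\int[mu]_(x in @I01 R) (q \_ (D i)) x)%E.
  by rewrite -integral_mkcondr (setIidr (br_sub BS (i:=i))).
rewrite (expanding_system_integral sys)//; last exact: measurable_funTS.
apply: eq_bigr => p _; rewrite (mp_change_var (pc p))//; last exact: measurable_funTS.
rewrite [RHS]integral_mkcondr; apply: eq_integral => y _.
rewrite !patchE; have -> : (y \in tau p @^-1` D i) = (tau p y \in D i) by [].
by case: ifPn => _; rewrite ?mul0e// /q EFinM muleA.
Qed.

End branches.

(** * Transfer operators as sums over inverse branches *)

Section transfer.
Context {R : realType}.
Local Notation mu := (@lebesgue_measure R).
Let m01 := @measurable_I01 R.

Lemma aeS (P Q : R -> Prop) : (forall x, P x -> Q x) ->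
  {ae mu, forall x, P x} -> {ae mu, forall x, Q x}.
Proof.
move=> PQ; apply: (@negligibleS _ _ _ mu) => x /=.
by apply: contra_not; exact: PQ.
Qed.

Lemma aeI (P Q : R -> Prop) : {ae mu, forall x, P x} ->
  {ae mu, forall x, Q x} -> {ae mu, forall x, P x /\ Q x}.
Proof.
move=> aP aQ; apply: (@negligibleS _ _ _ mu _ _ _ (@negligibleU _ _ _ mu _ _ aP aQ)).
by move=> x /= /not_andP.
Qed.

Lemma I01_measure : mu (@I01 R) = 1%E.
Proof. by rewrite /I01 lebesgue_measure_itv/= lte_fin ltr01 sube0. Qed.

Lemma I01_finite : (mu (@I01 R) < +oo)%E.
Proof. by rewrite I01_measure ltry. Qed.

Lemma bounded_L1 (f : R -> R) (B : R) : measurable_fun (@I01 R) f ->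
  (forall x, I01 x -> `|f x| <= B) -> L1 f.
Proof.
move=> mf fB; apply: measurable_bounded_integrable => //.
  exact: I01_finite.
exists B; split; first exact: num_real.
by move=> M BM x /fB /le_trans; apply; exact: ltW.
Qed.

Lemma bounded_Linfty (g : R -> R) (B : R) : measurable_fun (@I01 R) g ->
  (forall x, I01 x -> `|g x| <= B) -> Linfty g.
Proof. by move=> mg gB; split => //; exists B; apply: aeW => x; exact: gB. Qed.

Lemma L1_measurable (f : R -> R) : L1 f -> measurable_fun (@I01 R) f.
Proof. by move=> /measurable_int /measurable_EFinP. Qed.

Lemma L1_mul_Linfty (f g : R -> R) : L1 f -> Linfty g ->
  L1 (fun x => f x * g x).
Proof.
move=> L1f [mg [K gK]]; have mf := L1_measurable L1f.
have mfg : measurable_fun (@I01 R) (fun x => f x * g x) by exact: measurable_funM.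
apply/integrableP; split; first exact/measurable_EFinP.
apply: (@le_lt_trans _ _ (\int[mu]_(x in @I01 R) (`|K|%:E * `|(f x)%:E|))%E).
  apply: ae_ge0_le_integral => //.
  - by apply: measurableT_comp => //; exact/measurable_EFinP.
  - by apply: measurable_funeM; apply: measurableT_comp => //; exact/measurable_EFinP.
  - apply: aeS gK => x /= gKx Ix; rewrite -EFinM lee_fin normrM mulrC.
    by rewrite ler_wpM2r// (le_trans (gKx Ix))// ler_norm.
rewrite ge0_integralZl//; last first.
  by apply: measurableT_comp => //; exact/measurable_EFinP.
by apply: lte_mul_pinfty => //; case/integrableP: L1f.
Qed.

Lemma L1_ae_unique (h h' : R -> R) : L1 h -> L1 h' ->
  (forall g, Linfty g -> (\int[mu]_(x in @I01 R) (h x * g x)%:E =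
                          \int[mu]_(x in @I01 R) (h' x * g x)%:E)%E) ->
  ae_eq mu (@I01 R) h h'.
Proof.
move=> L1h L1h' hh'.
have : ae_eq mu (@I01 R) (EFin \o h) (EFin \o h').
  apply: integral_ae_eq => //; first exact: measurable_int L1h'.
  move=> E E01 mE.
  have LE : Linfty (\1_E : R -> R).
    apply: (@bounded_Linfty _ 1); first exact: measurable_funTS.
    by move=> x _; rewrite indicE; case: (_ \in _); rewrite ?normr1 ?normr0.
  have ind (k : R -> R) : (\int[mu]_(x in E) (k x)%:E =
      \int[mu]_(x in @I01 R) (k x * \1_E x)%:E)%E.
    rewrite -[in LHS](setIidr E01) integral_mkcondr.
    apply: eq_integral => x _; rewrite patchE indicE.
    by case: (_ \in _); rewrite ?mulr1 ?mulr0.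
  by rewrite !ind hh'.
by apply: aeS => x hx /hx [].
Qed.

(* When inv and wt are the inverse branches of S and their derivatives, this is
   a representative of P_S F, defined at every point. *)
Definition branch_sum (I : finType) (D : I -> set R) (inv wt : I -> R -> R)
    (F : R -> R) (x : R) : R :=
  \sum_(i : I) ((fun y => F (inv i y) * wt i y) \_ (D i)) x.

Section branch_sum.
Variables (S : R -> R) (I : finType) (D : I -> set R) (inv wt : I -> R -> R).
Hypothesis BS : branches S D inv wt.
Local Notation Pi := (branch_sum D inv wt).

(** Every [inv i x] is mapped to x, so g(S) factors out. This turns conservation of integrals into
    the duality that defines the transfer operator. *)
Lemma branch_sum_mul (F g : R -> R) x :
  Pi (fun y => F y * g (S y)) x = Pi F x * g x.
Proof.
rewrite /branch_sum mulr_suml; apply: eq_bigr => i _; rewrite !patchE.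
case: ifPn => [/set_mem Dx|_]; last by rewrite mul0r.
by have [_ ->] := br_inv BS Dx; rewrite mulrAC.
Qed.

Lemma branch_sumB (F G : R -> R) x : Pi (F \- G) x = Pi F x - Pi G x.
Proof.
rewrite /branch_sum -sumrB; apply: eq_bigr => i _; rewrite !patchE.
by case: ifPn => _; rewrite ?subr0// mulrBl.
Qed.

Lemma branch_sum_sum (J : Type) (s : seq J) (F : J -> R -> R) x :
  Pi (fun y => \sum_(j <- s) F j y) x = \sum_(j <- s) Pi (F j) x.
Proof.
rewrite /branch_sum exchange_big/=; apply: eq_bigr => i _; rewrite patchE.
case: ifPn => Dx; last by rewrite big1// => j _; rewrite patchE (negbTE Dx).
by rewrite mulr_suml; apply: eq_bigr => j _; rewrite patchE Dx.
Qed.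

Lemma branch_sumZ (c : R) (F : R -> R) x : Pi (fun y => c * F y) x = c * Pi F x.
Proof.
rewrite /branch_sum mulr_sumr; apply: eq_bigr => i _; rewrite !patchE.
by case: ifPn => _; rewrite ?mulr0// mulrA.
Qed.

Lemma branch_sum_le (F G : R -> R) x : (forall y, I01 y -> F y <= G y) ->
  Pi F x <= Pi G x.
Proof.
move=> FG; apply: ler_sum => i _; rewrite !patchE.
case: ifPn => // /set_mem Dx; apply: ler_wpM2r; first exact: (br_wt BS Dx).
by apply: FG; case: (br_inv BS Dx).
Qed.

Lemma branch_sum_norm_le (F : R -> R) (B : R) x :
  (forall y, I01 y -> `|F y| <= B) -> `|Pi F x| <= B * Pi (cst 1) x.
Proof.
move=> FB; rewrite -branch_sumZ ler_norml -mulN1r -branch_sumZ; apply/andP; split;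
  apply: branch_sum_le => y /FB; rewrite /cst mulr1 ?mulN1r ler_norml => /andP[].
- by [].
- by [].
Qed.

Lemma measurable_branch_sum (F : R -> R) : measurable_fun (@I01 R) F ->
  measurable_fun setT (Pi F).
Proof.
move=> mF; apply: measurable_sum => i.
have mD := br_measurable i BS.
apply/(measurable_restrictT _ mD); apply: measurable_funM.
  apply: (measurable_comp m01 _ mF (br_measurable_inv BS (i:=i))).
  by move=> _ [x Dx <-]; case: (br_inv BS Dx).
exact: (br_measurable_wt BS (i:=i)).
Qed.

Lemma branch_sum_ge0_integral (F : R -> R) : measurable_fun (@I01 R) F ->
  (forall x, I01 x -> 0 <= F x) ->
  (\int[mu]_(x in @I01 R) (F x)%:E = \int[mu]_(x in @I01 R) (Pi F x)%:E)%E.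
Proof.
move=> mF F0; rewrite (br_integral BS)//; last exact/measurable_EFinP.
under [RHS]eq_integral do rewrite -sumEFin.
rewrite ge0_integral_sum//; last 2 first.
- move=> i; apply: measurable_funTS; apply/measurable_EFinP.
  have mD := br_measurable i BS.
  apply/(measurable_restrictT _ mD); apply: measurable_funM.
    apply: (measurable_comp m01 _ mF (br_measurable_inv BS (i:=i))).
    by move=> _ [x Dx <-]; case: (br_inv BS Dx).
  exact: (br_measurable_wt BS (i:=i)).
- move=> i x _; rewrite lee_fin patchE; case: ifPn => // /set_mem Dx.
  by rewrite mulr_ge0 ?(br_wt BS Dx)// F0//; case: (br_inv BS Dx).
apply: eq_bigr => i _; rewrite -[in LHS](setIidr (br_sub BS (i:=i))).
rewrite integral_mkcondr; apply: eq_integral => x _; rewrite !patchE.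
by case: ifPn => // _; rewrite EFinM.
Qed.

Lemma branch_sum_L1 (F : R -> R) : L1 F -> L1 (Pi F) /\
  (\int[mu]_(x in @I01 R) (Pi F x)%:E = \int[mu]_(x in @I01 R) (F x)%:E)%E.
Proof.
move=> L1F.
have ge0_L1 (G : R -> R) : L1 G -> (forall x, 0 <= G x) -> L1 (Pi G).
  move=> L1G G0; have mG := L1_measurable L1G.
  apply/integrableP; split.
    by apply/measurable_EFinP/measurable_funTS; exact: measurable_branch_sum.
  case/integrableP: L1G => _; under eq_integral do rewrite /= ger0_norm//.
  rewrite branch_sum_ge0_integral//; congr (_ < _)%E.
  apply: eq_integral => x _; rewrite /= ger0_norm//.
  apply: sumr_ge0 => i _; rewrite patchE; case: ifPn => // /set_mem Dx.
  by rewrite mulr_ge0 ?(br_wt BS Dx).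
(* [br_integral] concerns nonnegative functions, hence the split into positive and negative
   parts. *)
have L1p : L1 F^\+ by exact: integrable_funrpos.
have L1n : L1 F^\- by exact: integrable_funrneg.
have p0 x : 0 <= F^\+ x by exact: funrpos_ge0.
have n0 x : 0 <= F^\- x by exact: funrneg_ge0.
have FE x : F x = F^\+ x - F^\- x by rewrite -[in LHS](funrposBneg F).
have PE x : Pi F x = Pi F^\+ x - Pi F^\- x.
  by rewrite -branch_sumB; congr (branch_sum _ _ _ _ x); apply/funext => y; rewrite FE.
pose pp := Pi F^\+; pose pn := Pi F^\-.
have L1Pp := ge0_L1 _ L1p p0; have L1Pn := ge0_L1 _ L1n n0.
split.
  have : mu.-integrable (@I01 R) ((EFin \o pp) \- (EFin \o pn))%E.
    exact: integrableB.
  by apply: eq_integrable => // x _; rewrite /= PE.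
under eq_integral do rewrite PE EFinB.
rewrite integralB_EFin// -!branch_sum_ge0_integral//; last 2 first.
- exact: L1_measurable L1n.
- exact: L1_measurable L1p.
rewrite -integralB_EFin//; apply: eq_integral => x _.
by rewrite -EFinB -FE.
Qed.

End branch_sum.

End transfer.

(** * Nonsingularity, and duality for the iterated operators *)

Section iterates.
Context {R : realType}.
Local Notation mu := (@lebesgue_measure R).
Let m01 := @measurable_I01 R.

(** [transfer] is obtained by choice, with a default value; [ns_transfer] says that the chosen
    function is a genuine representative of P_T f. *)
Record nonsingular_map (T : R -> R) : Prop := {
  ns_measurable : measurable_fun (@I01 R) T;
  ns_map : forall x, I01 x -> I01 (T x);
  ns_ae : forall P : R -> Prop, {ae mu, forall x, I01 x -> P x} ->
    {ae mu, forall x, I01 x -> P (T x)};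
  ns_transfer : forall f, L1 f -> is_transfer T f (transfer T f) }.

(** For a null set N, the measure of its preimage under S is the integral over N of the branch sum
    of 1, hence 0. *)
Lemma branches_ae_comp (S : R -> R) (I : finType) (D : I -> set R)
    (inv wt : I -> R -> R) (P : R -> Prop) :
  branches S D inv wt -> measurable_fun (@I01 R) S ->
  (forall x, I01 x -> I01 (S x)) ->
  {ae mu, forall x, I01 x -> P x} -> {ae mu, forall x, I01 x -> P (S x)}.
Proof.
move=> BS mS S01 [N [mN N0 PN]].
pose N' := @I01 R `&` S @^-1` N.
have mN' : measurable N' by exact: mS.
exists N'; split => //; last first.
  move=> x /= /not_implyP[Ix nP]; split => //=.
  by apply: PN => /= /(_ (S01 _ Ix)).
have m1 : measurable_fun (@I01 R) (cst 1 : R -> R) by exact: measurable_cst.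
have mi : measurable_fun (@I01 R) (fun x => cst 1 x * (\1_N (S x) : R)).
  apply: measurable_funM => //; apply: measurableT_comp => //.
transitivity (\int[mu]_(x in @I01 R) (cst 1 x * (\1_N (S x) : R))%:E)%E.
  rewrite -[LHS]mul1e -integral_cst// integral_mkcondr.
  apply: eq_integral => x _; rewrite patchE /cst mul1r indicE.
  have -> : (x \in S @^-1` N) = (S x \in N) by [].
  by case: (_ \in _).
rewrite (branch_sum_ge0_integral BS mi); last first.
  by move=> x _; rewrite /cst mul1r.
under eq_integral do rewrite (branch_sum_mul BS).
transitivity (\int[mu]_(x in @I01 R `&` N) (branch_sum D inv wt (cst 1) x)%:E)%E.
  rewrite integral_mkcondr; apply: eq_integral => x _.
  by rewrite patchE indicE; case: (_ \in _); rewrite ?mulr1 ?mulr0.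
apply: null_set_integral.
- exact: measurableI.
- apply/measurable_EFinP/measurable_funTS.
  exact: (measurable_branch_sum BS).
- by apply: subset_measure0 N0 => //; exact: measurableI.
Qed.

(** T is measurable on each piece, and outside the pieces every preimage is countable. *)
Lemma expanding_system_measurable (T : R -> R) (la M : R) N
    (U K : 'I_N -> set R) (tau w : 'I_N -> R -> R) :
  expanding_system T la M U K tau w -> measurable_fun (@I01 R) T.
Proof.
move=> sys.
have mU p : measurable (U p) by exact: open_measurable (mp_openU (es_piece sys p)).
have cm (C : set R) : countable C -> measurable C.
  by apply: countable_measurable => t; exact: measurable_set1.
pose V := \big[setU/set0]_(p <- enum 'I_N) U p.
have UE : \bigcup_p U p = V.
  rewrite /V -bigcup_seq; apply/seteqP; split => x [p _ Upx]; exists p => //=.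
  by rewrite mem_enum.
have VT : measurable_fun V T.
  rewrite /V; elim: (enum 'I_N) => [|p s ih].
    by rewrite big_nil; exact: measurable_fun_set0.
  rewrite big_cons; apply/measurable_funU => //.
    by apply: bigsetU_measurable.
  by split => //; exact: mp_measurable_map (es_piece sys p).
have mV : measurable V by exact: bigsetU_measurable.
have -> : @I01 R = V `|` (@I01 R `\` V).
  rewrite setDUK// -UE => x [p _]; exact: (es_subU sys).
apply/measurable_funU => //; first exact: measurableD.
split => // _ Y mY; apply: cm.
apply: sub_countable (es_cover sys); apply: subset_card_le.
by rewrite UE => x [].
Qed.

Lemma expanding_system_branches (T : R -> R) (la M : R) N
    (U K : 'I_N -> set R) (tau w : 'I_N -> R -> R) :
  expanding_system T la M U K tau w -> exists (I : finType)
  (D : I -> set R) (inv wt : I -> R -> R), branches T D inv wt.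
Proof.
by move=> sys; do 4 eexists; exact: (branches_comp (@branches_id R) sys).
Qed.

Lemma expanding_system_nonsingular (T : R -> R) (la M : R) N
    (U K : 'I_N -> set R) (tau w : 'I_N -> R -> R) :
  expanding_system T la M U K tau w -> (forall x, I01 x -> I01 (T x)) ->
  nonsingular_map T.
Proof.
move=> sys T01; have mT := expanding_system_measurable sys.
have [I [D [inv [wt BT]]]] := expanding_system_branches sys.
have aeT P := @branches_ae_comp T I D inv wt P BT mT T01.
split => // f L1f.
(* The branch sum witnesses that the choice made by [transfer] succeeds. *)
have : is_transfer T f (branch_sum D inv wt f).
  split; first by case: (branch_sum_L1 BT L1f).
  move=> g [mg [k gk]].
  have LgT : Linfty (g \o T).
    split; first by apply: (measurable_comp m01 _ mg mT) => _ [x /T01 + <-].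
    by exists k; exact: (aeT (fun y => `|g y| <= k)).
  have [_ <-] := branch_sum_L1 BT (L1_mul_Linfty L1f LgT).
  by apply: eq_integral => x _; rewrite (branch_sum_mul BT).
by move=> fP; apply: (@xgetPex _ _ [set h | is_transfer T f h]); eexists; exact: fP.
Qed.

Lemma Linfty_comp (T g : R -> R) : nonsingular_map T -> Linfty g ->
  Linfty (g \o T).
Proof.
move=> nT [mg [k gk]]; split.
  apply: (measurable_comp m01 _ mg (ns_measurable nT)) => _ [x + <-].
  exact: ns_map nT x.
by exists k; exact: ns_ae nT (fun y => `|g y| <= k) gk.
Qed.

Section sequence.
Variable Ts : nat -> R -> R.
Hypothesis nTs : forall n, (1 <= n)%N -> nonsingular_map (Ts n).

Lemma iter_map_I01 n x : I01 x -> I01 (iter_map Ts n x).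
Proof. by move=> Ix; elim: n => [//|n ih] /=; exact: ns_map (nTs _) _ ih. Qed.

Lemma measurable_iter_map n : measurable_fun (@I01 R) (iter_map Ts n).
Proof.
elim: n => [|n ih] /=; first exact: measurable_id.
apply: (measurable_comp m01 _ (ns_measurable (nTs _)) ih) => // _ [x + <-].
exact: iter_map_I01.
Qed.

Lemma iter_map_ae n (P : R -> Prop) : {ae mu, forall x, I01 x -> P x} ->
  {ae mu, forall x, I01 x -> P (iter_map Ts n x)}.
Proof.
elim: n P => [//|n ih] P aP /=.
by apply: (ih (fun y => P (Ts n.+1 y))); exact: ns_ae (nTs _) _ aP.
Qed.

Lemma Linfty_iter n g : Linfty g -> Linfty (g \o iter_map Ts n).
Proof.
elim: n g => [//|n ih] g Lg /=.
by apply: (ih (g \o Ts n.+1)); exact: Linfty_comp (nTs _) Lg.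
Qed.

Lemma iter_transfer_dual n f : L1 f -> L1 (iter_transfer Ts n f) /\
  forall g, Linfty g ->
   (\int[mu]_(x in @I01 R) (iter_transfer Ts n f x * g x)%:E =
    \int[mu]_(x in @I01 R) (f x * g (iter_map Ts n x))%:E)%E.
Proof.
move=> L1f; elim: n => [//|n [L1n dual_n]] /=.
have [L1' dual'] := ns_transfer (nTs (ltn0Sn n)) L1n.
split => // g Lg; rewrite dual'//.
exact: (dual_n (g \o Ts n.+1) (Linfty_comp (nTs (ltn0Sn n)) Lg)).
Qed.

(** Both sides are dual to composition with T_1^n, and duality determines an integrable function
    a.e. This carries the hypotheses on transfer operators over to the explicit sums. *)
Lemma iter_transfer_branch_sum n (I : finType) (D : I -> set R)
    (inv wt : I -> R -> R) f : branches (iter_map Ts n) D inv wt -> L1 f ->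
  ae_eq mu (@I01 R) (iter_transfer Ts n f) (branch_sum D inv wt f).
Proof.
move=> BS L1f; have [L1n dual_n] := iter_transfer_dual n L1f.
apply: L1_ae_unique => //; first by case: (branch_sum_L1 BS L1f).
move=> g Lg; rewrite dual_n//.
have [_ <-] := branch_sum_L1 BS (L1_mul_Linfty L1f (Linfty_iter n Lg)).
by apply: eq_integral => x _; rewrite (branch_sum_mul BS).
Qed.

End sequence.

Lemma iter_map_shift (Ts : nat -> R -> R) i l x :
  iter_map Ts (i + l) x = iter_map (fun k => Ts (i + k)%N) l (iter_map Ts i x).
Proof. by elim: l => [|l ih]; rewrite ?addn0// addnS /= ih addnS. Qed.

Lemma iter_transfer_shift (Ts : nat -> R -> R) i l f :
  iter_transfer Ts (i + l) f =
  iter_transfer (fun k => Ts (i + k)%N) l (iter_transfer Ts i f).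
Proof. by elim: l => [|l ih]; rewrite ?addn0// addnS /= ih addnS. Qed.

(** Allows (Dec) to be applied from time i on, starting from the explicit sum at time i, whose
    variation can be computed. *)
Lemma iter_transfer_branch_sum_shift (Ts : nat -> R -> R) i l
    (I : finType) (D : I -> set R) (inv wt : I -> R -> R)
    (I' : finType) (D' : I' -> set R) (inv' wt' : I' -> R -> R) f :
  (forall n, (1 <= n)%N -> nonsingular_map (Ts n)) ->
  branches (iter_map Ts i) D inv wt ->
  branches (iter_map Ts (i + l)) D' inv' wt' -> L1 f ->
  ae_eq mu (@I01 R)
    (iter_transfer (fun k => Ts (i + k)%N) l (branch_sum D inv wt f))
    (branch_sum D' inv' wt' f).
Proof.
move=> nTs BS BS' L1f.
have nTsi n : (1 <= n)%N -> nonsingular_map (Ts (i + n)%N).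
  by move=> n1; apply: nTs; rewrite addn_gt0 n1 orbT.
have [L1b _] := branch_sum_L1 BS L1f.
have [L1n dual_n] := @iter_transfer_dual (fun k => Ts (i + k)%N) nTsi l _ L1b.
apply: L1_ae_unique => //; first by case: (branch_sum_L1 BS' L1f).
move=> g Lg; rewrite dual_n//.
have Lgi := @Linfty_iter (fun k => Ts (i + k)%N) nTsi l _ Lg.
under eq_integral do rewrite -(branch_sum_mul BS f
  (fun x => g (iter_map (fun k => Ts (i + k)%N) l x))).
have [_ ->] := branch_sum_L1 BS
  (L1_mul_Linfty L1f (Linfty_iter nTs i Lgi)).
have [_] := branch_sum_L1 BS'
  (L1_mul_Linfty L1f (Linfty_iter nTs (i + l)%N Lg)).
under eq_integral do rewrite (branch_sum_mul BS').
by move=> ->; apply: eq_integral => x _; rewrite /= iter_map_shift.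
Qed.

End iterates.

(** * Variation of sums over inverse branches *)

Section bounded_variation.
Context {R : realType}.
Local Notation mu := (@lebesgue_measure R).
Let m01 := @measurable_I01 R.

(** The increments of phi telescope along any partition. *)
Lemma total_variation_dominated (f phi : R -> R) :
  (forall x y, 0 <= x -> x <= y -> y <= 1 -> `|f y - f x| <= phi y - phi x) ->
  (total_variation 0 1 f <= (phi 1 - phi 0)%:E)%E.
Proof.
move=> fphi; apply: ge_ereal_sup => _ [_ [s s01 <-] <-]; rewrite lee_fin.
have : forall s a, 0 <= a -> itv_partition a 1 s ->
    variation a 1 f s <= phi 1 - phi a.
  elim=> [|h t ih] a a0 ps.
    by rewrite variation_nil (itv_partition_nil ps) subrr.
  have pt := itv_partition_cons ps.
  have h1 := itv_partition_le pt.
  have ah : a <= h by case: ps => /= /andP[/ltW].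
  have -> : variation a 1 f (h :: t) = `|f h - f a| + variation h 1 f t.
    by rewrite /variation/= big_nat_recl.
  have := lerD (fphi _ _ a0 ah h1) (ih _ (le_trans a0 ah) pt).
  by rewrite [X in _ <= X -> _]addrC addrA subrK.
exact.
Qed.

(* Nondecreasing in x; its increments dominate those of any function that is
   L-Lipschitz and bounded by B on D and vanishes off D. *)
Definition bump (D : set R) (L B : R) (x : R) : R :=
  if x \in D then L * x + B
  else if `[< exists2 z, D z & z < x >] then L + 2 * B else 0.

(** Entering D raises [bump] by at least B, inside it grows with slope L, and past D it equals L +
    2B, which is at least B above L x + B because x <= 1. *)
Lemma bump_dominates (D : set R) (u : R -> R) (L B x y : R) :
  is_interval D -> D `<=` @I01 R -> 0 <= L -> 0 <= B ->
  (forall x, D x -> `|u x| <= B) ->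
  (forall x y, D x -> D y -> `|u x - u y| <= L * `|x - y|) ->
  0 <= x -> x <= y -> y <= 1 ->
  `|(u \_ D) y - (u \_ D) x| <= bump D L B y - bump D L B x.
Proof.
move=> iD D01 L0 B0 uB uL x0 xy y1; rewrite !patchE /bump.
have [/set_mem Dx|nDx] := boolP (x \in D); have [/set_mem Dy|nDy] := boolP (y \in D).
- apply: le_trans (uL _ _ Dy Dx) _.
  by rewrite ger0_norm ?subr_ge0//; lra.
- rewrite asboolT; last first.
    exists x => //; rewrite lt_neqAle xy andbT; apply: contraNneq nDy => <-.
    exact/mem_set.
  rewrite sub0r normrN (le_trans (uB _ Dx))//.
  have : L * x <= L * 1 by rewrite ler_wpM2l// (le_trans xy).
  lra.
- rewrite asboolF; last first.
    move=> [z Dz zx]; move/negP: nDx; apply; apply/mem_set.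
    by apply: iD Dz Dy _ _; rewrite ltW.
  rewrite !subr0 (le_trans (uB _ Dy))// lerDr mulr_ge0//.
  exact: le_trans xy.
- rewrite subrr normr0 subr_ge0.
  case: asboolP => [[z Dz zx]|_].
    by rewrite asboolT//; exists z => //; exact: lt_le_trans xy.
  by case: ifP => // _; rewrite addr_ge0// mulr_ge0.
Qed.

Lemma bump_range (D : set R) (L B : R) : D `<=` @I01 R -> 0 <= L -> 0 <= B ->
  bump D L B 1 - bump D L B 0 <= L + 2 * B.
Proof.
move=> D01 L0 B0.
have b1 : bump D L B 1 <= L + 2 * B.
  by rewrite /bump; case: ifP => _; [lra|case: ifP => _; lra].
have b0 : 0 <= bump D L B 0.
  by rewrite /bump; case: ifP => _; [lra|case: ifP => _; lra].
lra.
Qed.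

(** One [bump] per branch: the possible jumps at the two ends of its domain cost 2 [B i], its
    interior at most [L i]. *)
Lemma branch_sum_variation (S : R -> R) (I : finType) (D : I -> set R)
    (inv wt : I -> R -> R) (F : R -> R) (L B : I -> R) :
  branches S D inv wt ->
  (forall i, 0 <= L i) -> (forall i, 0 <= B i) ->
  (forall i x, D i x -> `|F (inv i x) * wt i x| <= B i) ->
  (forall i x y, D i x -> D i y ->
    `|F (inv i x) * wt i x - F (inv i y) * wt i y| <= L i * `|x - y|) ->
  (total_variation 0 1 (branch_sum D inv wt F) <=
    (\sum_(i : I) (L i + 2 * B i))%:E)%E.
Proof.
move=> BS L0 B0 FB FL.
apply: le_trans (@total_variation_dominated _
  (fun x => \sum_(i : I) bump (D i) (L i) (B i) x) _) _.
  move=> x y x0 xy y1; rewrite /branch_sum -!sumrB.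
  apply: le_trans (ler_norm_sum _ _ _) _; apply: ler_sum => i _.
  by apply: bump_dominates => //;
    [exact: br_itv BS i|exact: br_sub BS i|exact: FB|exact: FL].
rewrite lee_fin -sumrB; apply: ler_sum => i _.
by apply: bump_range => //; exact: br_sub BS i.
Qed.

Lemma ess_variation_le (f g : R -> R) : ae_eq mu (@I01 R) g f ->
  (ess_variation f <= total_variation 0 1 g)%E.
Proof. by move=> gf; apply: ereal_inf_lbound; exists g. Qed.

Lemma ess_variation_ge0 (f : R -> R) : (0 <= ess_variation f)%E.
Proof.
apply: le_ereal_inf_tmp => _ [g _ <-].
by apply: total_variation_ge0.
Qed.

Lemma norm_L1_ge0 (f : R -> R) : (0 <= norm_L1 f)%E.
Proof. by apply: integral_ge0 => x _; rewrite lee_fin. Qed.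

Lemma variation_dist (g : R -> R) (V x y : R) :
  (total_variation 0 1 g <= V%:E)%E -> I01 x -> I01 y -> `|g x - g y| <= V.
Proof.
wlog xy : x y / x <= y => [hw gV Ix Iy|].
  have [xy|/ltW yx] := leP x y; first exact: hw.
  by rewrite distrC; exact: hw.
rewrite /I01/= !in_itv/= => gV /andP[x0 _] /andP[_ y1]; rewrite distrC.
rewrite -lee_fin (le_trans _ gV)//.
apply: le_trans (total_variation_ge g xy) _.
rewrite (@total_variationD _ 0 1 x)//; last exact: le_trans y1.
rewrite (@total_variationD _ x 1 y)//.
rewrite addeCA leeDl// adde_ge0// total_variation_ge0//.
Qed.

Lemma integral_cst_I01 (k : R) : (\int[mu]_(x in @I01 R) k%:E = k%:E)%E.
Proof.
by rewrite /I01 integral_cst//= lebesgue_measure_itv/= lte_fin ltr01 sube0 mule1.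
Qed.

(** A function exceeds the mean of its absolute value by at most its variation. The infimum defining
    the essential variation need not be attained, so a representative within c of it is taken; hence
    the factor 2. *)
Lemma norm_BV_bound (f : R -> R) (c : R) : L1 f -> 0 < c ->
  (norm_BV f <= c%:E)%E -> {ae mu, forall x, I01 x -> `|f x| <= 2 * c}.
Proof.
move=> L1f c0 fc.
have V0 := ess_variation_ge0 f; have N0 := norm_L1_ge0 f.
have Vfin : ess_variation f \is a fin_num.
  rewrite ge0_fin_numE// (le_lt_trans _ (ltry c))//.
  by apply: le_trans fc; rewrite /norm_BV leeDl.
have Nfin : norm_L1 f \is a fin_num.
  rewrite ge0_fin_numE// (le_lt_trans _ (ltry c))//.
  by apply: le_trans fc; rewrite /norm_BV leeDr.
have [_ [g gf <-] gV] := lb_ereal_inf_adherent c0 Vfin.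
set v := fine (ess_variation f); set n := fine (norm_L1 f).
have vnc : v + n <= c by rewrite -lee_fin EFinD !fineK.
have gvc : (total_variation 0 1 g <= (v + c)%:E)%E.
  by rewrite EFinD fineK//; exact: ltW.
have L1af : mu.-integrable (@I01 R) (fun x => (`|f x|)%:E).
  by have /integrable_norm := L1f.
apply: aeS (gf) => x gfx Ix; rewrite -gfx//.
suff : `|g x| - (v + c) <= n by lra.
have [k0|/ltW k0] := leP 0 (`|g x| - (v + c)); last first.
  by apply: le_trans k0 _; exact: fine_ge0.
rewrite -lee_fin /n fineK// -integral_cst_I01; apply: ae_ge0_le_integral => //.
- by apply/measurable_EFinP/measurableT_comp => //; exact: L1_measurable.
- apply: aeS gf => y gfy Iy; rewrite lee_fin -gfy//.
  have := variation_dist gvc Ix Iy; have := ler_normD (g x - g y) (g y).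
  by rewrite subrK; lra.
Qed.

End bounded_variation.

(** * Uniform bound on the sum of the suprema of the branch weights *)

Section good_branches.
Context {R : realType}.
Local Notation mu := (@lebesgue_measure R).

Lemma I01_dist (x y : R) : I01 x -> I01 y -> `|x - y| <= 1.
Proof.
rewrite /I01/= !in_itv/= => /andP[x0 x1] /andP[y0 y1].
by rewrite ler_norml; apply/andP; split; lra.
Qed.

Lemma ae_ball (c e : R) (P : R -> Prop) : 0 < e ->
  ball c e `<=` @I01 R -> {ae mu, forall x, I01 x -> P x} ->
  exists2 y, ball c e y & P y.
Proof.
move=> e0 cI aP; apply: contrapT => nP.
have bad : ball c e `<=` ~` [set x | I01 x -> P x].
  by move=> y cy /= /(_ (cI _ cy)) Py; apply: nP; exists y.
have : mu (ball c e) = 0%E.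
  apply: measure_negligible; first exact: measurable_ball.
  exact: (@negligibleS _ _ _ mu _ _ bad aP).
rewrite lebesgue_measure_ball ?ltW// => /eqP.
by rewrite eqe mulrn_eq0/= gt_eqF.
Qed.

Section sup_weight.
Variables (D : set R) (f : R -> R) (a : R).
Hypothesis a0 : 0 <= a.
Hypothesis D01 : D `<=` @I01 R.
Hypothesis f0 : forall x, D x -> 0 <= f x.
Hypothesis fa : forall x y, D x -> D y -> f x <= f y * expR (a * `|x - y|).

Lemma weight_ratio x y : D x -> D y -> f x <= f y * expR a.
Proof.
move=> Dx Dy; apply: le_trans (fa Dx Dy) _.
rewrite ler_wpM2l ?f0// ler_expR -[leRHS]mulr1 ler_wpM2l//.
by apply: I01_dist; exact: D01.
Qed.

Lemma le_sup_weight x : D x -> f x <= sup (f @` D).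
Proof.
move=> Dx; apply: ub_le_sup; last by exists x.
by exists (f x * expR a) => _ [y Dy <-]; exact: weight_ratio.
Qed.

Lemma sup_weight_le x : D x -> sup (f @` D) <= f x * expR a.
Proof.
move=> Dx; apply: ge_sup; first by exists (f x), x.
by move=> _ [y Dy <-]; exact: weight_ratio.
Qed.

Lemma sup_weight_ge0 : 0 <= sup (f @` D).
Proof.
have [[x Dx]|D0] := pselect (D !=set0).
  exact: le_trans (f0 Dx) (le_sup_weight Dx).
suff -> : f @` D = set0 by rewrite sup0.
by apply/seteqP; split => // z [x Dx _]; apply: D0; exists x.
Qed.

(** Distortion on a set of diameter at most 1 gives a Lipschitz constant proportional to the
    supremum, so the sum of these constants over the branches is controlled by the sum of the
    suprema. *)
Lemma weight_lipschitz x y : D x -> D y ->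
  `|f x - f y| <= a * expR a * sup (f @` D) * `|x - y|.
Proof.
wlog fxy : x y / f y <= f x => [hw Dx Dy|Dx Dy].
  case/orP: (le_total (f y) (f x)) => fxy; first exact: hw.
  by rewrite distrC (distrC x); exact: hw.
have d1 : `|x - y| <= 1 by apply: I01_dist; exact: D01.
set d := `|x - y| in d1 *.
have d0 : 0 <= d by exact: normr_ge0.
rewrite ger0_norm ?subr_ge0//.
(* e^s - 1 <= s e^s follows from 1 - s <= e^(-s) *)
have es : expR (a * d) - 1 <= a * d * expR a.
  have h : 1 - a * d <= expR (- (a * d)) by rewrite expR_ge1Dx.
  have : expR (a * d) * (1 - a * d) <= 1.
    by rewrite -[leRHS](expRxMexpNx_1 (a * d)) ler_wpM2l ?expR_ge0.
  have e1 : expR (a * d) <= expR a by rewrite ler_expR -[leRHS]mulr1 ler_wpM2l.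
  have : a * d * expR (a * d) <= a * d * expR a by rewrite ler_wpM2l ?mulr_ge0.
  lra.
apply: (@le_trans _ _ (f y * (expR (a * d) - 1))).
  by rewrite mulrBr mulr1 lerB// fa.
apply: le_trans (ler_wpM2l (f0 Dy) es) _.
rewrite (_ : _ * _ * _ * _ = sup [set f x | x in D] * (a * d * expR a)); last by ring.
by rewrite ler_wpM2r ?le_sup_weight// !mulr_ge0// expR_ge0.
Qed.

End sup_weight.

Variables (Ts : nat -> R -> R) (la M : R) (N : nat).
Hypotheses (la1 : 1 < la) (M0 : 0 <= M).
Hypothesis sys : forall n, (1 <= n)%N ->
  exists U K tau w, @expanding_system R (Ts n) la M N U K tau w.

(** Geometric series: E is the sum of la^-j over j >= 0, and a the sum of M la^-j over j >= 1. The
    relations E = E/la + 1 and a = a/la + M/la make the bounds pass from n to n + 1. *)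
Let E := la / (la - 1).
Let a := M / (la - 1).

(* Branches with an empty domain have weight sup set0 = 0 in gb_weights. *)
Record good_branches (n : nat) (W : R) (I : finType) (D : I -> set R)
    (inv wt : I -> R -> R) : Prop := {
  gb_branches : branches (iter_map Ts n) D inv wt;
  gb_orbit : forall i x y, D i x -> D i y ->
    \sum_(j < n.+1) `|iter_map Ts j (inv i x) - iter_map Ts j (inv i y)| <=
      E * `|x - y|;
  gb_distortion : forall i x y, D i x -> D i y ->
    wt i x <= wt i y * expR (a * `|x - y|);
  gb_weights : \sum_(i : I) sup (wt i @` D i) <= W }.

Let la0 : 0 < la. Proof. exact: lt_trans la1. Qed.
Let la10 : 0 < la - 1. Proof. by rewrite subr_gt0. Qed.
Let a0 : 0 <= a. Proof. by rewrite divr_ge0// ltW. Qed.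
Let E1 : 1 <= E. Proof. by rewrite ler_pdivlMr// mul1r lerBlDr lerDl. Qed.

Lemma card_sum (T : finType) (P : pred T) : #|[pred p | P p]| = (\sum_p P p)%N.
Proof.
by rewrite -sum1_card big_mkcond; apply: eq_bigr => p _; rewrite inE; case: (P p).
Qed.

(** Among the disjoint intervals meeting the interval D, all but the leftmost have their left end
    point in D. *)
Lemma count_cut (U : 'I_N -> set R) (D : set R) :
  (forall p, is_interval (U p)) -> (forall p, U p `<=` @I01 R) ->
  trivIset setT U -> is_interval D ->
  (#|[pred p | `[< (U p `&` D) !=set0 >]]| <=
     1 + #|[pred p | `[< D (inf (U p)) >]]|)%N.
Proof.
move=> iU U01 tU iD.
set A := [pred p | _]; set B := [pred p | _].
have AB : (#|[predD A & B]| <= 1)%N.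
  apply/card_le1P => p; rewrite inE => /andP[pB pA] q.
  rewrite !inE; apply/idP/idP => [/andP[qB qA]|/eqP->]; last first.
    by rewrite pB.
  apply/eqP; apply/esym.
  move: pA qA pB qB => /asboolP[x [Ux Dx]] /asboolP[y [Vy Dy]].
  move=> /asboolPn npB /asboolPn nqB.
  have lbU r : has_lbound (U r).
    by exists 0 => z /U01; rewrite /I01/= in_itv/= => /andP[].
  have aux r s x' y' : U r x' -> D x' -> U s y' -> D y' -> x' <= y' ->
      ~ D (inf (U s)) -> r = s.
    move=> Urx Dx' Usy Dy' xy nD; apply: contrapT => rs.
    have sy : inf (U s) <= y' by exact: ge_inf.
    have [xs|sx] := leP x' (inf (U s)).
      by apply: nD; apply: iD Dx' Dy' _ _; rewrite xs sy.
    have [z Uz zx] : exists2 z, U s z & z < x'.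
      by apply: inf_lt sx; exists y'.
    apply: rs; apply: tU => //; exists x'; split => //.
    by apply: (iU s) Uz Usy _ _; rewrite xy andbT ltW.
  have [xy|/ltW yx] := leP x y; first exact: aux Ux Dx Vy Dy xy nqB.
  by apply/esym; exact: aux Vy Dy Ux Dx yx npB.
rewrite -(cardID B A) addnC leq_add//.
by apply/subset_leq_card/fintype.subsetP => p; rewrite !inE => /andP[_ /asboolP].
Qed.

(** The bound C4 holds only a.e. and may fail at c. The finitely many open domains containing c
    share a neighbourhood of c, hence a point y where the bound holds; distortion compares the
    suprema with the weights at y, at the cost of exp a. *)
Lemma crossing_weights (n : nat) (W C4 : R) (I : finType) (D : I -> set R)
    (inv wt : I -> R -> R) (c : R) : 0 <= C4 ->
  good_branches n W D inv wt ->
  {ae mu, forall x, I01 x -> branch_sum D inv wt (cst 1) x <= C4} ->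
  \sum_(i : I | `[< D i c >]) sup (wt i @` D i) <= expR a * C4.
Proof.
move=> C40 gb aeC4; have BS := gb_branches gb.
have [[i0 Di0]|noD] := pselect (exists i, D i c); last first.
  rewrite big_pred0 ?mulr_ge0 ?expR_ge0// => i; apply/negbTE/asboolPn => Di.
  by apply: noD; exists i.
have : \forall y \near c, forall i, D i c -> D i y.
  apply: (@filter_forall R I (fun i => [set y | D i c -> D i y]) (nbhs c)) => i.
  have [Dic|nDic] := pselect (D i c); last by near=> y => /nDic.
  near=> y => _; near: y; apply: open_nbhs_nbhs; split => //.
  exact: br_open BS i.
move=> /nbhs_ballP[e /= e0 eD].
have cI : ball c e `<=` @I01 R.
  by move=> y /eD /(_ i0 Di0); exact: br_sub BS i0 y.
have [y cy yC4] := ae_ball e0 cI aeC4.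
apply: (@le_trans _ _ (\sum_(i | `[< D i c >]) expR a * (wt i \_ (D i)) y)).
  apply: ler_sum => i /asboolP Dic; have Diy := eD _ cy _ Dic.
  rewrite patchE mem_set// mulrC.
  by apply: sup_weight_le => //;
    [exact: br_sub BS i|exact: br_wt BS i|exact: gb_distortion gb i].
rewrite -mulr_sumr ler_wpM2l ?expR_ge0// (le_trans _ yC4)//.
rewrite /branch_sum [leRHS](bigID (fun i => `[< D i c >]))/=.
rewrite -[leLHS]addr0 lerD//.
  by apply: ler_sum => i _; rewrite !patchE /cst mul1r.
apply: sumr_ge0 => i _; rewrite patchE; case: ifPn => // /set_mem Diy.
by rewrite /cst mul1r; exact: br_wt BS i y Diy.
Unshelve. all: by end_near. Qed.

Lemma good_branches0 (W : R) : 1 <= W ->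
  good_branches 0 W (fun _ : 'I_1 => `]0, 1[%classic) (fun _ => id)
    (fun _ => cst 1).
Proof.
move=> W1; split.
- exact: branches_id.
- by move=> _ x y _ _; rewrite big_ord1 /= ler_peMl.
- by move=> _ x y _ _; rewrite /cst mul1r -expR0 ler_expR mulr_ge0.
- rewrite big_ord1 (_ : _ @` _ = [set 1]) ?sup1//.
  apply/seteqP; split => [_ [x _ <-]//|_ ->]; exists (2^-1) => //.
  by rewrite /= in_itv/=; apply/andP; split; lra.
Qed.

Lemma good_branches_step (n : nat) (C4 : R) (I : finType) (D : I -> set R)
    (inv wt : I -> R -> R) :
  let W := 1 + N%:R * (expR a * C4) / (la - 1) in
  0 <= C4 -> good_branches n W D inv wt ->
  {ae mu, forall x, I01 x -> branch_sum D inv wt (cst 1) x <= C4} ->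
  exists (J : finType) (D' : J -> set R) (inv' wt' : J -> R -> R),
    good_branches n.+1 W D' inv' wt'.
Proof.
move=> W C40 gb aeC4; have BS := gb_branches gb.
have [U [K [tau [w es]]]] := sys (ltn0Sn n); have pc := es_piece es.
have BS' := branches_comp BS es.
have lai0 : 0 <= la^-1 by rewrite invr_ge0 ltW.
have lai1 : la^-1 <= 1 by rewrite invf_le1// ltW.
exists (I * 'I_N)%type; do 3 eexists; split; first exact: BS'.
- move=> [i p] x y D'x D'y; have [Kx Dx] := D'x; have [Ky Dy] := D'y.
  rewrite big_ord_recr /=.
  have [_ /= ->] := br_inv BS' (i := (i, p)) D'x.
  have [_ /= ->] := br_inv BS' (i := (i, p)) D'y.
  have -> : E * `|x - y| = E * (la^-1 * `|x - y|) + `|x - y|.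
    rewrite /E; field; rewrite gt_eqF//= gt_eqF//.
  rewrite lerD2r (le_trans (gb_orbit gb Dx Dy))// ler_wpM2l ?(le_trans _ E1)//.
  exact: (mp_lip (pc p) Kx Ky).
- move=> [i p] x y /= [Kx Dx] [Ky Dy].
  have /andP[/ltW wx0 _] := mp_wt (pc p) Kx.
  have -> : wt i (tau p y) * w p y * expR (a * `|x - y|) =
     (wt i (tau p y) * expR (a * (la^-1 * `|x - y|))) *
     (w p y * expR (M / la * `|x - y|)).
    rewrite mulrACA -expRD -!mulrA; do 2 congr (_ * _).
    by rewrite /a; congr expR; field; rewrite !gt_eqF.
  apply: ler_pM => //; first exact: (br_wt BS Dx).
    apply: le_trans (gb_distortion gb Dx Dy) _.
    rewrite ler_wpM2l ?(br_wt BS Dy)// ler_expR ler_wpM2l//.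
    exact: (mp_lip (pc p) Kx Ky).
  exact: (mp_distortion (pc p) Kx Ky).
pose G i := sup (wt i @` D i).
have G0 i : 0 <= G i.
  by apply: (sup_weight_ge0 a0);
    [exact: br_sub BS i|exact: br_wt BS i|exact: gb_distortion gb i].
(* T cuts D i only at left endpoints inf (U p) lying in D i, and the weights of
   the branches containing a given point add up to at most expR a * C4, so the
   total weight S satisfies la * S' <= S + N * (expR a * C4). *)
pose meets i p := `[< (U p `&` D i) !=set0 >].
rewrite -(pair_bigA _ (fun i p => sup ((fun x => wt i (tau p x) * w p x) @`
  (K p `&` tau p @^-1` D i))))/=.
apply: (@le_trans _ _ (\sum_(i : I) \sum_(p < N) la^-1 * G i * (meets i p)%:R)).
  apply: ler_sum => i _; apply: ler_sum => p _.
  have [mip|nmip] := boolP (meets i p); last first.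
    rewrite mulr0 (_ : _ @` _ = set0) ?sup0//.
    apply/seteqP; split => // z [x [Kx Dx] _]; move/asboolPn: nmip; apply.
    by exists (tau p x); split => //; case: (mp_inv (pc p) Kx).
  rewrite mulr1; apply: ge_sup.
    move/asboolP: mip => [x [Ux Dx]]; have [Kx tx] := mp_map (pc p) Ux.
    by eexists; exists (Ts n.+1 x) => //; split => //=; rewrite tx.
  move=> _ [x [Kx Dx] <-]; have /andP[/ltW wx0 wla] := mp_wt (pc p) Kx.
  rewrite mulrC; apply: ler_pM => //; first exact: (br_wt BS Dx).
  by apply: (le_sup_weight a0) => //;
    [exact: br_sub BS i|exact: br_wt BS i|exact: gb_distortion gb i].
apply: (@le_trans _ _ (la^-1 * (\sum_(i : I) G i +
    \sum_(i : I) \sum_(p < N) G i * (`[< D i (inf (U p)) >])%:R))).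
  rewrite -big_split/= mulr_sumr; apply: ler_sum => i _.
  rewrite -mulr_sumr -mulrA ler_wpM2l// -mulr_sumr -{2}[G i]mulr1 -mulrDr.
  rewrite ler_wpM2l// -!natr_sum nat1r ler_nat.
  have := count_cut (fun p => mp_itvU (pc p)) (es_subU es) (es_disjoint es)
    (br_itv BS (i:=i)).
  by rewrite !card_sum add1n.
have cross p : \sum_(i : I) G i * (`[< D i (inf (U p)) >])%:R <= expR a * C4.
  apply: le_trans (crossing_weights (inf (U p)) C40 gb aeC4).
  rewrite [leRHS]big_mkcond/=; apply: ler_sum => i _.
  by case: ifP; rewrite ?mulr1 ?mulr0.
rewrite ler_pdivrMl// exchange_big/=.
have : \sum_(p < N) \sum_(i : I) G i * (`[< D i (inf (U p)) >])%:R <=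
    N%:R * (expR a * C4).
  apply: le_trans (ler_sum _ (fun p _ => cross p)) _.
  by rewrite sumr_const card_ord mulr_natl.
have := gb_weights gb; rewrite -/G.
set X := N%:R * (expR a * C4); set s1 := \sum_(i : I) _; set s2 := \sum_(p < N) _.
move=> s1W s2X.
(* W is the fixed point X/(la - 1) of S -> (S + X)/la, plus 1 to cover the identity, whose only
   branch has weight 1. *)
have XE : la * W = W + X + (la - 1).
  by rewrite /W -/X; field; rewrite gt_eqF.
by rewrite XE; move: la10; lra.
Qed.

Lemma good_branches_exist (C4 : R) : 0 <= C4 ->
  (forall n (I : finType) (D : I -> set R) (inv wt : I -> R -> R),
    branches (iter_map Ts n) D inv wt ->
    {ae mu, forall x, I01 x -> branch_sum D inv wt (cst 1) x <= C4}) ->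
  forall n, exists (J : finType) (D : J -> set R) (inv wt : J -> R -> R),
    good_branches n (1 + N%:R * (expR a * C4) / (la - 1)) D inv wt.
Proof.
move=> C40 aeC4; elim=> [|n [I [D [inv [wt gb]]]]].
  do 4 eexists; apply: good_branches0.
  by rewrite lerDl divr_ge0 ?mulr_ge0 ?expR_ge0// ltW.
exact: (good_branches_step C40 gb (aeC4 _ _ _ _ _ (gb_branches gb))).
Qed.

End good_branches.

(** * Bounds in the BV norm: densities, regularity along branches, decay *)

Section spectral.
Context {R : realType}.
Local Notation mu := (@lebesgue_measure R).
Let m01 := @measurable_I01 R.

Lemma L1_cst (c : R) : L1 (cst c : R -> R).
Proof. by apply: (@bounded_L1 _ _ `|c|) => // x _. Qed.

Lemma BV_norm (f : R -> R) (c : R) : L1 f -> (norm_BV f <= c%:E)%E -> BV f.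
Proof.
move=> L1f fc; split => //; apply: le_lt_trans (ltry c); apply: le_trans fc.
by rewrite /norm_BV leeDl// norm_L1_ge0.
Qed.

Lemma norm_BV_cst1 : (norm_BV (cst 1%R : R -> R) <= 1%:E)%E.
Proof.
rewrite /norm_BV -[leRHS]add0e; apply: leeD.
  have h : ae_eq mu (@I01 R) (cst 1%R : R -> R) (cst 1%R) by exact: aeW.
  apply: le_trans (ess_variation_le h) _.
  apply: le_trans (@total_variation_dominated R _ (cst 0%R) _) _; last by rewrite subrr.
  by move=> x y _ _ _; rewrite subrr normr0 subrr.
rewrite /norm_L1; under eq_integral do rewrite normr1.
by rewrite integral_cst_I01.
Qed.

Section branches_of_iterates.
Variables (Ts : nat -> R -> R) (la M : R) (N : nat).
Hypothesis sys : forall n, (1 <= n)%N ->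
  exists U K tau w, @expanding_system R (Ts n) la M N U K tau w.

Lemma iter_branches n : exists (I : finType) (D : I -> set R)
  (inv wt : I -> R -> R), branches (iter_map Ts n) D inv wt.
Proof.
elim: n => [|n [I [D [inv [wt BS]]]]].
  by do 4 eexists; exact: branches_id.
have [U [K [tau [w es]]]] := sys (ltn0Sn n).
by do 4 eexists; exact: (branches_comp BS es).
Qed.

Hypothesis nTs : forall n, (1 <= n)%N -> nonsingular_map (Ts n).

Lemma norm_L1_iter_cst1 n : norm_L1 (iter_transfer Ts n (cst 1)) = 1%:E.
Proof.
have [I [D [inv [wt BS]]]] := iter_branches n.
have L1n := (iter_transfer_dual nTs n (L1_cst 1)).1.
have ae1 := iter_transfer_branch_sum nTs BS (L1_cst 1).
have [L1b b1] := branch_sum_L1 BS (L1_cst 1).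
transitivity (\int[mu]_(x in @I01 R) (branch_sum D inv wt (cst 1%R) x)%:E)%E.
  apply: ae_eq_integral => //.
  - by apply/measurable_EFinP/measurableT_comp => //; exact: L1_measurable.
  - by apply/measurable_EFinP; exact: L1_measurable.
  apply: aeS ae1 => x h Ix; rewrite h// ger0_norm//.
  apply: sumr_ge0 => i _; rewrite patchE; case: ifPn => // /set_mem Dx.
  by rewrite /cst mul1r (br_wt BS Dx).
by rewrite b1 /cst integral_cst_I01.
Qed.

(** Strong induction by steps of r >= 1: the L1 norm of P_1^n 1 stays equal to 1, so (D_r) gives u_n
    <= rho u_(n-r) + Cr for the BV norms u_n. *)
Lemma iter_cst1_bound (C : set (R -> R)) (r : nat) : (1 <= r)%N ->
  cond_D C r -> (forall n, (1 <= n)%N -> C (Ts n)) ->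
  exists2 X : R, 0 < X &
    forall n, (norm_BV (iter_transfer Ts n (cst 1%R)) <= X%:E)%E.
Proof.
move=> r1 [rho [M0 [Cr [/andP[rho0 rho1] M00 Cr0 D1 Dr]]]] CT.
pose m := Num.max 1 M0; have m1 : 1 <= m by rewrite le_max lexx.
have m0 : 0 <= m by exact: le_trans m1.
pose u n := iter_transfer Ts n (cst 1).
have L1u n : L1 (u n) by exact: (iter_transfer_dual nTs n (L1_cst 1)).1.
have crude n : (norm_BV (u n) <= (m ^+ n)%:E)%E.
  elim: n => [|n ih]; first by rewrite expr0; exact: norm_BV_cst1.
  have BVn : BV (u n) by exact: BV_norm ih.
  apply: le_trans (D1 _ _ (CT _ (ltn0Sn n)) BVn) _.
  rewrite exprS EFinM; apply: lee_pmul => //.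
  - by rewrite lee_fin ltW.
  - by rewrite adde_ge0 ?norm_L1_ge0 ?ess_variation_ge0.
  - by rewrite lee_fin le_max lexx orbT.
(* The second term is the fixed point of u -> rho u + Cr; the first covers the iterates before time
   r, bounded by powers of the one-step constant. *)
pose X := m ^+ r + Cr / (1 - rho).
have rho10 : 0 < 1 - rho by rewrite subr_gt0.
have mr0 : 0 < m ^+ r by rewrite exprn_gt0// (lt_le_trans ltr01).
have X0 : 0 < X by rewrite addr_gt0// divr_gt0.
exists X => // n; elim/ltn_ind: n => n ih.
have [nr|rn] := ltnP n r.
  apply: le_trans (crude n) _; rewrite lee_fin (@le_trans _ _ (m ^+ r))//.
    by rewrite ler_weXn2l// ltnW.
  by rewrite lerDl divr_ge0// ltW.
pose i := (n - r)%N; have nE : n = (i + r)%N by rewrite subnK.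
have BVi : BV (u i) by exact: BV_norm (crude i).
have CTi k : (1 <= k <= r)%N -> C (Ts (i + k)%N).
  by move=> /andP[k1 _]; apply: CT; rewrite addn_gt0 k1 orbT.
rewrite nE iter_transfer_shift; apply: le_trans (Dr _ _ CTi BVi) _.
rewrite norm_L1_iter_cst1 mule1.
apply: (@le_trans _ _ (rho%:E * X%:E + Cr%:E)%E).
  rewrite leeD2r// lee_wpmul2l ?lee_fin ?(ltW rho0)// ih//.
  by rewrite /i ltn_subrL r1 (leq_trans r1 rn).
rewrite -EFinM -EFinD lee_fin.
have XE : X = rho * X + (1 - rho) * m ^+ r + Cr.
  by rewrite /X; field; rewrite gt_eqF.
by rewrite [leRHS]XE lerD2r lerDl mulr_ge0// ltW.
Qed.

Lemma branch_sum_cst1_bound (C : set (R -> R)) (r : nat) : (1 <= r)%N ->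
  cond_D C r -> (forall n, (1 <= n)%N -> C (Ts n)) ->
  exists2 C4 : R, 0 <= C4 &
    forall n (I : finType) (D : I -> set R) (inv wt : I -> R -> R),
    branches (iter_map Ts n) D inv wt ->
    {ae mu, forall x, I01 x -> branch_sum D inv wt (cst 1) x <= C4}.
Proof.
move=> r1 DC CT; have [X X0 uX] := iter_cst1_bound r1 DC CT.
exists (2 * X); first by rewrite mulr_ge0// ltW.
move=> n I D inv wt BS.
have L1n := (iter_transfer_dual nTs n (L1_cst 1)).1.
have := aeI (norm_BV_bound L1n X0 (uX n))
  (iter_transfer_branch_sum nTs BS (L1_cst 1)).
apply: aeS => x [h1 h2] Ix; rewrite -h2//.
by apply: le_trans (h1 Ix); exact: ler_norm.
Qed.

End branches_of_iterates.

(** On a branch, F(inv) times the weight has size at most B sup wt and Lipschitz constant (Lf + B a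
    exp a) sup wt, and the suprema add up to at most W. The last B bounds the L1 norm. *)
Lemma branch_sum_norm_BV (Ts : nat -> R -> R) (la M W : R) (n : nat)
    (I : finType) (D : I -> set R) (inv wt : I -> R -> R)
    (F : R -> R) (B Lf : R) :
  let a := M / (la - 1) in
  0 <= a -> 0 <= B -> 0 <= Lf ->
  good_branches Ts la M n W D inv wt -> measurable_fun (@I01 R) F ->
  (forall x, I01 x -> `|F x| <= B) ->
  (forall i x y, D i x -> D i y -> `|F (inv i x) - F (inv i y)| <= Lf * `|x - y|) ->
  (norm_BV (branch_sum D inv wt F) <=
     (W * (Lf + B * (a * expR a) + 2 * B) + B)%:E)%E.
Proof.
move=> a a0 B0 Lf0 gb mF FB FL; have BS := gb_branches gb.
have L1F : L1 F by exact: bounded_L1 FB.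
have Lc0 : 0 <= Lf + B * (a * expR a).
  by apply: addr_ge0 => //; rewrite mulr_ge0// mulr_ge0// expR_ge0.
pose G i := sup (wt i @` D i).
have sub i := br_sub BS (i := i).
have wt0 i x (Dx : D i x) := br_wt BS Dx.
have G0 i : 0 <= G i.
  by apply: (sup_weight_ge0 a0 (sub i)) => *; [exact: wt0|exact: (gb_distortion gb)].
have wG i x : D i x -> wt i x <= G i.
  move=> Dx; apply: (le_sup_weight a0 (sub i)) => // *;
    by [exact: wt0|exact: (gb_distortion gb)].
have wL i x y : D i x -> D i y -> `|wt i x - wt i y| <= a * expR a * G i * `|x - y|.
  move=> Dx Dy; apply: (weight_lipschitz a0 (sub i)) => // *;
    by [exact: wt0|exact: (gb_distortion gb)].
have Finv i x : D i x -> `|F (inv i x)| <= B.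
  by move=> Dx; apply: FB; case: (br_inv BS Dx).
rewrite /norm_BV EFinD; apply: leeD.
  apply: le_trans (ess_variation_le (_ : ae_eq mu (@I01 R) _ _)) _.
    by apply: aeW => x _; reflexivity.
  apply: le_trans (@branch_sum_variation _ _ _ D inv wt F
    (fun i => (Lf + B * (a * expR a)) * G i) (fun i => B * G i) BS _ _ _ _) _.
  - by move=> i; exact: mulr_ge0.
  - by move=> i; rewrite mulr_ge0.
  - move=> i x Dx; rewrite normrM (ger0_norm (wt0 _ _ Dx)).
    by apply: ler_pM => //; [exact: wt0|exact: Finv|exact: wG].
  - move=> i x y Dx Dy.
    have -> : F (inv i x) * wt i x - F (inv i y) * wt i y =
        (F (inv i x) - F (inv i y)) * wt i x + F (inv i y) * (wt i x - wt i y).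
      by ring.
    apply: le_trans (ler_normD _ _) _; rewrite !normrM (ger0_norm (wt0 _ _ Dx)).
    have -> : (Lf + B * (a * expR a)) * G i * `|x - y| =
        Lf * `|x - y| * G i + B * (a * expR a * G i * `|x - y|) by ring.
    by apply: lerD; apply: ler_pM => //; [exact: wt0|exact: FL|exact: wG|exact: Finv|exact: wL].
  rewrite lee_fin.
  rewrite [leLHS](_ : _ = (Lf + B * (a * expR a) + 2 * B) * \sum_i G i); last first.
    by rewrite mulr_sumr; apply: eq_bigr => i _; ring.
  rewrite mulrC ler_wpM2r ?(gb_weights gb)//.
  by rewrite addr_ge0// mulr_ge0.
have [L1b b1] := branch_sum_L1 BS (L1_cst 1).
apply: (@le_trans _ _ (\int[mu]_(x in @I01 R) (B * branch_sum D inv wt (cst 1%R) x)%:E)%E).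
  apply: ge0_le_integral => //.
  - apply/measurable_EFinP/measurableT_comp => //.
    by apply: measurable_funTS; exact: (measurable_branch_sum BS).
  - apply/measurable_EFinP/measurable_funM => //.
    exact: L1_measurable.
  - by move=> x Ix; rewrite lee_fin (branch_sum_norm_le BS)//.
under eq_integral do rewrite -branch_sumZ.
rewrite (branch_sum_L1 BS _).2; last first.
  rewrite (_ : (fun y : R => B * cst 1 y) = cst B); first exact: L1_cst.
  by apply/funext => y; rewrite /cst mulr1.
under eq_integral do rewrite /cst mulr1.
by rewrite integral_cst_I01.
Qed.

(** (Dec) starts at l = 1, and K0 + 1 also covers l = 0. The factor 2 is that of [norm_BV_bound]. *)
Lemma branch_sum_decay (C : set (R -> R)) (Ts : nat -> R -> R) (theta K0 c : R)
    (i l : nat) (I : finType) (D : I -> set R) (inv wt : I -> R -> R)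
    (I' : finType) (D' : I' -> set R) (inv' wt' : I' -> R -> R) (F : R -> R) :
  (forall (l : nat) Ts f, (1 <= l)%N ->
        (forall i, (1 <= i <= l)%N -> C (Ts i)) -> BV f ->
        (\int[mu]_(x in @I01 R) (f x)%:E = 0)%E ->
        (norm_BV (iter_transfer Ts l f) <= (K0 * theta ^+ l)%:E * norm_BV f)%E) ->
  0 < theta -> 0 < K0 -> 0 < c ->
  (forall n, (1 <= n)%N -> C (Ts n)) ->
  (forall n, (1 <= n)%N -> nonsingular_map (Ts n)) ->
  branches (iter_map Ts i) D inv wt ->
  branches (iter_map Ts (i + l)) D' inv' wt' ->
  L1 F -> (\int[mu]_(x in @I01 R) (F x)%:E = 0)%E ->
  (norm_BV (branch_sum D inv wt F) <= c%:E)%E ->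
  {ae mu, forall x, I01 x ->
    `|branch_sum D' inv' wt' F x| <= 2 * ((K0 + 1) * theta ^+ l * c)}.
Proof.
move=> Dec th0 K00 c0 CT nTs BS BS' L1F F0 Fc.
have [L1b b0] := branch_sum_L1 BS L1F.
have nTsi n : (1 <= n)%N -> nonsingular_map (Ts (i + n)%N).
  by move=> n1; apply: nTs; rewrite addn_gt0 n1 orbT.
have L1i := (@iter_transfer_dual _ (fun k => Ts (i + k)%N) nTsi l _ L1b).1.
have thl : 0 < theta ^+ l by rewrite exprn_gt0.
have ci0 : 0 < (K0 + 1) * theta ^+ l * c by rewrite !mulr_gt0// addr_gt0.
have bound : (norm_BV (iter_transfer (fun k => Ts (i + k)%N) l
    (branch_sum D inv wt F)) <= ((K0 + 1) * theta ^+ l * c)%:E)%E.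
  have [l0|l1] := posnP l.
    rewrite l0 /= expr0 mulr1 (le_trans Fc)// lee_fin.
    by apply: ler_peMl; lra.
  have CTi k : (1 <= k <= l)%N -> C (Ts (i + k)%N).
    by move=> /andP[k1 _]; apply: CT; rewrite addn_gt0 k1 orbT.
  apply: le_trans (Dec l (fun k => Ts (i + k)%N) _ l1 CTi (BV_norm L1b Fc) _) _.
    by rewrite b0.
  rewrite [leRHS]EFinM; apply: lee_pmul => //.
  - by rewrite lee_fin mulr_ge0// ltW.
  - by rewrite adde_ge0 ?norm_L1_ge0 ?ess_variation_ge0.
  - by rewrite lee_fin ler_wpM2r ?(ltW thl)// lerDl.
have := aeI (norm_BV_bound L1i ci0 bound)
  (iter_transfer_branch_sum_shift nTs BS BS' L1F).
by apply: aeS => x [h1 h2] Ix; rewrite -h2//; exact: h1.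
Qed.

End spectral.

(** * Concentration of mean-Lipschitz functions of the orbit *)

Section mean_lipschitz.
Context {R : realType}.
Local Notation mu := (@lebesgue_measure R).

Lemma I01E (x : R) : I01 x <-> 0 <= x <= 1.
Proof. by rewrite /I01/= in_itv. Qed.

Lemma clip_dist (y z : R) : I01 z -> `|clip 0 1 y - z| <= `|y - z|.
Proof.
move=> /I01E /andP[z0 z1]; rewrite /clip /Num.max /Num.min.
case: (ltP y 1) => y1; [case: (ltP 0 y) => y0 //|rewrite ltr01].
- by rewrite ler0_norm ?ler0_norm; lra.
- by rewrite ger0_norm ?ger0_norm; lra.
Qed.

(** Enumerates the finite lists of rationals, moved into [0, 1] and extended by 0. The family is
    dense in the first n coordinates; it serves for the measurability of kappa along orbits and for
    a null set common to all z. *)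
Definition rational_seq (m : nat) (k : nat) : R :=
  if unpickle m is Some s then clip 0 1 (ratr (nth 0 (s : seq rat) k)) else 0.

Lemma rational_seq_I01 m k : I01 (rational_seq m k).
Proof.
rewrite /rational_seq; case: unpickle => [s|]; apply/I01E.
  by apply: clip_bounds; exact: ltr01.
by rewrite lexx ler01.
Qed.

Lemma rational_seq_dense (n : nat) (z : nat -> R) (e : R) : 0 < e ->
  (forall k, I01 (z k)) ->
  exists m, forall k, (k < n)%N -> `|z k - rational_seq m k| <= e.
Proof.
move=> e0 z01.
have /choice[q qz] : forall k, exists q : rat, `|ratr q - z k| <= e.
  move=> k; have /rat_in_itvoo[q] : z k < z k + e by rewrite ltrDl.
  rewrite in_itv/= => /andP[h1 h2]; exists q.
  by rewrite ger0_norm; lra.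
exists (pickle (mkseq q n)) => k kn; rewrite /rational_seq pickleK nth_mkseq//.
by rewrite distrC (le_trans (clip_dist _ (z01 k))).
Qed.

(** The bound forces kappa to depend on the first n coordinates only. It is asked for all sequences,
    so that spliced and rational ones, which are not orbits, are included. *)
Definition mean_lipschitz (n : nat) (kappa : (nat -> R) -> R) :=
  forall xi xi', `|kappa xi - kappa xi'| <= n%:R^-1 * \sum_(k < n) `|xi k - xi' k|.

Variables (n : nat) (kappa : (nat -> R) -> R).
Hypotheses (n0 : (0 < n)%N) (kL : mean_lipschitz n kappa).

Let nR0 : 0 < n%:R :> R. Proof. by rewrite ltr0n. Qed.

Lemma mean_le (e : R) (f : nat -> R) : (forall k, (k < n)%N -> f k <= e) ->
  n%:R^-1 * \sum_(k < n) f k <= e.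
Proof.
move=> fe; rewrite ler_pdivrMl//.
have h : \sum_(k < n) f k <= \sum_(k < n) e by apply: ler_sum => k _; exact: fe.
by apply: le_trans h _; rewrite sumr_const card_ord mulr_natl.
Qed.

Lemma mean_lipschitz_bounded (xi : nat -> R) : (forall k, I01 (xi k)) ->
  `|kappa xi| <= `|kappa (fun=> 0)| + 1.
Proof.
move=> xi01; have h : `|kappa xi - kappa (fun=> 0)| <= 1.
  apply: le_trans (kL xi (fun=> 0)) _.
  apply: (mean_le (f := fun k => `|xi k - 0|)) => k _.
  by apply: I01_dist => //; apply/I01E; rewrite lexx ler01.
have := ler_normD (kappa xi - kappa (fun=> 0)) (kappa (fun=> 0)).
by rewrite subrK; lra.
Qed.

(* kappa is the infimum over rational q of the measurable functions
   kappa q + mean |f - q| *)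
Lemma measurable_mean_lipschitz (f : nat -> R -> R) :
  (forall k, measurable_fun (@I01 R) (f k)) ->
  (forall k x, I01 x -> I01 (f k x)) ->
  measurable_fun (@I01 R) (fun x => kappa (f^~ x)).
Proof.
move=> mf f01.
pose g m x := kappa (rational_seq m) +
  n%:R^-1 * \sum_(k < n) `|rational_seq m k - f k x|.
have mg m : measurable_fun (@I01 R) (g m).
  apply: measurable_funD => //; apply: measurable_funM => //.
  apply: measurable_sum => k; apply: measurableT_comp => //.
  by apply: measurable_funB => //; exact: measurable_cst.
apply: (measurability _ (RGenInftyO.measurableE R)).
move=> _ [_ [a ->] <-].
have -> : @I01 R `&` (fun x => kappa (f^~ x)) @^-1` `]-oo, a[ =
    \bigcup_m (@I01 R `&` g m @^-1` `]-oo, a[).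
  apply/seteqP; split => x.
    move=> [Ix /=]; rewrite in_itv/= => xa.
    (* One third for the change of kappa, one third for the mean distance added in [g]; the last
       keeps the inequality strict. *)
    pose e := (a - kappa (f^~ x)) / 3.
    have e0 : 0 < e by rewrite divr_gt0// subr_gt0.
    have [m me] := @rational_seq_dense n (f^~ x) e e0 (fun k => f01 k x Ix).
    exists m => //; split => //=; rewrite in_itv/= /g.
    have h1 : n%:R^-1 * \sum_(k < n) `|rational_seq m k - f k x| <= e.
      by apply: (mean_le (f := fun k => `|rational_seq m k - f k x|)) => k kn; rewrite distrC; exact: me.
    have := le_trans (kL (rational_seq m) (f^~ x)) h1.
    by rewrite ler_norml => /andP[_]; rewrite /e in h1 *; lra.
  move=> [m _ [Ix]] /=; rewrite !in_itv/= => H; split => //.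
  change (kappa (f^~ x) < a).
  apply: le_lt_trans H; rewrite /g.
  have := kL (f^~ x) (rational_seq m).
  under eq_bigr do rewrite distrC.
  by rewrite ler_norml => /andP[_]; lra.
by apply: bigcupT_measurable => m; apply: mg => //; exact: measurable_I01.
Qed.

End mean_lipschitz.

(** * Real-valued integrals and one step of Azuma's inequality *)

Section mean.
Context {R : realType}.
Local Notation mu := (@lebesgue_measure R).
Let m01 : @measurable _ (measurableTypeR R) (@I01 R) := @measurable_I01 R.

Definition mean (F : R -> R) : R := fine (\int[mu]_(x in @I01 R) (F x)%:E)%E.

Lemma meanE (F : R -> R) : L1 F ->
  (\int[mu]_(x in @I01 R) (F x)%:E = (mean F)%:E)%E.
Proof. by move=> L1F; rewrite /mean fineK//; exact: integrable_fin_num. Qed.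

Lemma mean_cst (k : R) : mean (cst k) = k.
Proof. by rewrite /mean /cst integral_cst_I01. Qed.

Lemma L1_D (F G : R -> R) : L1 F -> L1 G -> L1 (fun x => F x + G x).
Proof. by move=> L1F L1G; have := integrableD m01 L1F L1G. Qed.

Lemma L1_Z (k : R) (F : R -> R) : L1 F -> L1 (fun x => k * F x).
Proof. by move=> L1F; have := integrableZl m01 k L1F. Qed.

Lemma meanD (F G : R -> R) : L1 F -> L1 G ->
  mean (fun x => F x + G x) = mean F + mean G.
Proof.
move=> L1F L1G; apply: EFin_inj; rewrite EFinD -!meanE//; last exact: L1_D.
by under eq_integral do rewrite EFinD; rewrite integralD_EFin.
Qed.

Lemma meanZ (k : R) (F : R -> R) : L1 F -> mean (fun x => k * F x) = k * mean F.
Proof.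
move=> L1F; apply: EFin_inj; rewrite EFinM -!meanE//; last exact: L1_Z.
by under eq_integral do rewrite EFinM; rewrite integralZl.
Qed.

Lemma L1_B (F G : R -> R) : L1 F -> L1 G -> L1 (fun x => F x - G x).
Proof.
move=> L1F L1G; have := L1_D L1F (L1_Z (-1) L1G).
by under eq_fun do rewrite mulN1r.
Qed.

Lemma meanB (F G : R -> R) : L1 F -> L1 G ->
  mean (fun x => F x - G x) = mean F - mean G.
Proof.
move=> L1F L1G; rewrite -[- mean G]mulN1r -meanZ// -meanD//; last exact: L1_Z.
by under eq_fun do rewrite -mulN1r.
Qed.

Lemma le_mean (F G : R -> R) : L1 F -> L1 G -> (forall x, I01 x -> F x <= G x) ->
  mean F <= mean G.
Proof.
move=> L1F L1G FG; rewrite -lee_fin -!meanE//.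
by apply: le_integral => // x /set_mem Ix; rewrite lee_fin FG.
Qed.

Lemma ae_le_mean (F G : R -> R) : L1 F -> L1 G ->
  {ae mu, forall x, I01 x -> F x <= G x} -> mean F <= mean G.
Proof.
move=> L1F L1G FG.
(* The maximum equals G a.e. and dominates F at every point. *)
pose H x := Num.max (F x) (G x).
have mF := L1_measurable L1F; have mG := L1_measurable L1G.
have mH : measurable_fun (@I01 R) H by exact: measurable_maxr.
have L1H : L1 H.
  apply: (@le_integrable _ _ _ mu _ m01 _ (fun x => (`|F x| + `|G x|)%:E)).
  - exact/measurable_EFinP.
  - move=> x _ /=; rewrite lee_fin [leRHS]ger0_norm ?addr_ge0//.
    by rewrite /H /Num.max; case: ifP => _; rewrite ?lerDl ?lerDr.
  - by apply: L1_D; apply: integrable_norm.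
have -> : mean G = mean H.
  apply: EFin_inj; rewrite -!meanE//; apply: ae_eq_integral => //;
    try exact/measurable_EFinP.
  apply: aeS FG => x FGx Ix; rewrite /H /Num.max; case: ltP => // GF.
  by apply/eqP; rewrite eqe eq_le GF FGx.
by apply: le_mean => // x _; rewrite le_max lexx.
Qed.

Lemma ae_eq_mean (F G : R -> R) : L1 F -> L1 G -> ae_eq mu (@I01 R) F G ->
  mean F = mean G.
Proof.
move=> L1F L1G FG; apply/eqP; rewrite eq_le; apply/andP; split;
by apply: ae_le_mean => //; apply: aeS FG => x h Ix; rewrite h.
Qed.

Lemma norm_mean_le (F : R -> R) (B : R) : L1 F ->
  (forall x, I01 x -> `|F x| <= B) -> `|mean F| <= B.
Proof.
move=> L1F FB; rewrite ler_norml -{1}(mean_cst (- B)) -{2}(mean_cst B).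
by apply/andP; split; apply: le_mean => //; try exact: L1_cst;
  move=> x /FB; rewrite /cst ler_norml => /andP[].
Qed.

Lemma aeC (P : nat -> R -> Prop) : (forall m, {ae mu, forall x, P m x}) ->
  {ae mu, forall x, forall m, P m x}.
Proof.
move=> aP; apply: (@negligibleS _ _ _ mu _ _ _ (@negligible_bigcup _ _ _ mu _ aP)).
by move=> x /= /existsNP[m Pm]; exists m.
Qed.

Lemma geometric_le (theta : R) p : 0 < theta < 1 ->
  \sum_(i < p.+1) theta ^+ (p - i) <= (1 - theta)^-1.
Proof.
move=> /andP[th0 th1]; have th10 : 0 < 1 - theta by rewrite subr_gt0.
rewrite -[leRHS]div1r ler_pdivlMr//.
elim: p => [|p ih]; first by rewrite big_ord1 expr0 mul1r; lra.
rewrite big_ord_recr/= subnn expr0.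
have -> : \sum_(i < p.+1) theta ^+ (p.+1 - i) =
    theta * \sum_(i < p.+1) theta ^+ (p - i).
  by rewrite mulr_sumr; apply: eq_bigr => i _; rewrite -exprS subSn// -ltnS.
by rewrite mulrDl -mulrA mul1r; have := ler_wpM2l (ltW th0) ih; lra.
Qed.

(** Plays the part of Hoeffding's lemma: for a martingale difference the linear term integrates to
    0. If u >= 1/2 then u <= 2u^2; otherwise exp u <= 1/(1 - u) <= 1 + u + 2u^2. *)
Lemma expR_le_linear_gauss (u : R) : expR u <= u + expR (2 * u ^+ 2).
Proof.
have [u12|u12] := leP (1 / 2) u.
  rewrite -[leLHS]add0r; apply: lerD; first by lra.
  by rewrite ler_expR; nra.
apply: (@le_trans _ _ (1 + u + 2 * u ^+ 2)); last first.
  by have := expR_ge1Dx (2 * u ^+ 2); lra.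
have h : expR u * (1 - u) <= 1.
  by rewrite -[leRHS](expRxMexpNx_1 u) ler_wpM2l ?expR_ge0// expR_ge1Dx.
have u1 : 0 < 1 - u by lra.
have -> : expR u = expR u * (1 - u) / (1 - u) by field; rewrite gt_eqF.
rewrite ler_pdivrMr//; apply: le_trans h _; nra.
Qed.

Section exponential.
Variables (F : R -> R) (B s : R).
Hypotheses (mF : measurable_fun (@I01 R) F) (FB : forall x, I01 x -> `|F x| <= B).

Let mexp : measurable_fun (@I01 R) (fun x => expR (s * F x)).
Proof.
apply: (measurableT_comp (@measurable_expR R)).
by apply: measurable_funM => //; exact: measurable_cst.
Qed.

Let expB x : I01 x -> `|expR (s * F x)| <= expR (`|s| * B).
Proof.
move=> Ix; rewrite ger0_norm ?expR_ge0// ler_expR.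
by rewrite (le_trans (ler_norm _))// normrM ler_wpM2l// FB.
Qed.

Lemma L1_expR : L1 (fun x => expR (s * F x)).
Proof. exact: bounded_L1 mexp expB. Qed.

Lemma Linfty_expR : Linfty (fun x => expR (s * F x)).
Proof. exact: bounded_Linfty mexp expB. Qed.

End exponential.

(** The last hypothesis makes Y - Z orthogonal to exp(s Z), which cancels the linear term of
    [expR_le_linear_gauss] taken at u = s(Y - Z). *)
Lemma azuma_step (Y Z : R -> R) (BY BZ s D : R) :
  measurable_fun (@I01 R) Y -> measurable_fun (@I01 R) Z ->
  (forall x, I01 x -> `|Y x| <= BY) -> (forall x, I01 x -> `|Z x| <= BZ) ->
  {ae mu, forall x, I01 x -> `|Y x - Z x| <= D} ->
  mean (fun x => Y x * expR (s * Z x)) = mean (fun x => Z x * expR (s * Z x)) ->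
  mean (fun x => expR (s * Y x)) <=
    expR (2 * (s * D) ^+ 2) * mean (fun x => expR (s * Z x)).
Proof.
move=> mY mZ YB ZB YZD orth.
have L1Y := L1_expR s mY YB; have L1Z := L1_expR s mZ ZB.
have LZ := Linfty_expR s mZ ZB.
have L1YZ : L1 (fun x => Y x * expR (s * Z x)).
  exact: L1_mul_Linfty (bounded_L1 mY YB) LZ.
have L1ZZ : L1 (fun x => Z x * expR (s * Z x)).
  exact: L1_mul_Linfty (bounded_L1 mZ ZB) LZ.
apply: (@le_trans _ _ (mean (fun x => s * (Y x * expR (s * Z x) - Z x * expR (s * Z x)) +
    expR (2 * (s * D) ^+ 2) * expR (s * Z x)))); last first.
  rewrite meanD; [|exact: L1_Z (L1_B _ _)|exact: L1_Z].
  by rewrite meanZ ?meanB ?meanZ ?orth ?subrr ?mulr0 ?add0r//; exact: L1_B.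
apply: ae_le_mean => //.
  by apply: L1_D; apply: L1_Z => //; exact: L1_B.
apply: aeS YZD => x YZx Ix; have {}YZx := YZx Ix.
have -> : expR (s * Y x) = expR (s * (Y x - Z x)) * expR (s * Z x).
  by rewrite -expRD; congr expR; ring.
rewrite -mulrBl mulrA -mulrDl ler_wpM2r ?expR_ge0//.
apply: le_trans (expR_le_linear_gauss _) _; rewrite lerD2l ler_expR ler_wpM2l//.
rewrite !exprMn ler_wpM2l ?sqr_ge0// -[leLHS]real_normK ?num_real//.
by rewrite ler_pXn2r// nnegrE (le_trans _ YZx).
Qed.

End mean.

(** * The reverse martingale of conditional expectations given T_1^p *)

Section concentration.
Context {R : realType}.
Local Notation mu := (@lebesgue_measure R).
Let m01 : @measurable _ (measurableTypeR R) (@I01 R) := @measurable_I01 R.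

(** Bundles the index type with its branches, so that a single choice supplies branches for all
    times p. *)
Record branch_family := BranchFamily {
  bf_index : finType;
  bf_dom : bf_index -> set R;
  bf_inv : bf_index -> R -> R;
  bf_wt : bf_index -> R -> R }.

Variables (C : set (R -> R)) (Ts : nat -> R -> R) (la M W theta K0 delta : R).
Variables (b : nat -> branch_family).
Hypotheses (la1 : 1 < la) (M0 : 0 <= M) (W0 : 0 <= W).
Hypotheses (CT : forall n, (1 <= n)%N -> C (Ts n)).
Hypotheses (nTs : forall n, (1 <= n)%N -> nonsingular_map (Ts n)).
Hypotheses (th01 : 0 < theta < 1) (K00 : 0 < K0).
Hypothesis Dec : forall (l : nat) Ts f, (1 <= l)%N ->
  (forall i, (1 <= i <= l)%N -> C (Ts i)) -> BV f ->
  (\int[mu]_(x in @I01 R) (f x)%:E = 0)%E ->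
  (norm_BV (iter_transfer Ts l f) <= (K0 * theta ^+ l)%:E * norm_BV f)%E.
Hypothesis bP : forall p, good_branches Ts la M p W
  (@bf_dom (b p)) (@bf_inv (b p)) (@bf_wt (b p)).
Local Notation Pi p := (branch_sum (@bf_dom (b p)) (@bf_inv (b p)) (@bf_wt (b p))).
Hypothesis delta0 : 0 < delta.
Hypothesis density_ge : forall p,
  {ae mu, forall x, I01 x -> delta <= Pi p (cst 1) x}.

Variables (n : nat) (kappa : (nat -> R) -> R).
Hypotheses (n0 : (0 < n)%N) (kL : mean_lipschitz n kappa).

Let nR0 : 0 < n%:R :> R. Proof. by rewrite ltr0n. Qed.
Let la10 : 0 < la - 1. Proof. by rewrite subr_gt0. Qed.
Let th0 : 0 < theta. Proof. by case/andP: th01. Qed.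
Let th10 : 0 < 1 - theta. Proof. by case/andP: th01; rewrite subr_gt0. Qed.
Let BS p := gb_branches (bP p).

Let E := la / (la - 1).
Let a := M / (la - 1).
(** n times the bound of [branch_sum_norm_BV] for a centred increment, with sup bound 2/n and
    Lipschitz constant 2E/n. [A] then sums the decay over the increments as a geometric series. *)
Let c := W * (2 * E + 2 * (a * expR a) + 4) + 2.
Let A := 2 * (K0 + 1) * c / (1 - theta).

Let E0 : 0 <= E.
Proof. by rewrite divr_ge0// ltW// (lt_trans ltr01). Qed.
Let a0 : 0 <= a. Proof. by rewrite divr_ge0// ltW. Qed.
Let c0 : 0 < c.
Proof.
apply: (@lt_le_trans _ _ 2) => //; rewrite lerDr mulr_ge0//.
have ea0 : 0 <= a * expR a by rewrite mulr_ge0// expR_ge0.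
by move: E0 ea0; lra.
Qed.
Let A0 : 0 < A.
Proof. by rewrite divr_gt0// mulr_gt0// mulr_gt0// addr_gt0. Qed.

Definition orbit (x : R) (k : nat) : R := iter_map Ts k x.

(** The increments h_i are differences of kappa at consecutive splices. At p = 0 nothing depends on
    x, so they add up to kappa minus a constant. *)
Definition splice (p : nat) (z : nat -> R) (x : R) (k : nat) : R :=
  if (k < p)%N then orbit x k else z k.

Local Notation Kz p z := (fun x => kappa (splice p z x)).
Local Notation Kf := (fun x => kappa (orbit x)).

Let orbit01 x k : I01 x -> I01 (orbit x k).
Proof. by move=> Ix; exact: iter_map_I01. Qed.

Let splice01 p z x k : (forall k, I01 (z k)) -> I01 x -> I01 (splice p z x k).
Proof. by move=> z01 Ix; rewrite /splice; case: ifP => // _; exact: orbit01. Qed.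

Let mKz p z : (forall k, I01 (z k)) -> measurable_fun (@I01 R) (Kz p z).
Proof.
move=> z01; apply: (@measurable_mean_lipschitz _ n kappa n0 kL (fun k x => splice p z x k)).
  move=> k; rewrite /splice; case: (k < p)%N; last exact: measurable_cst.
  exact: measurable_iter_map.
by move=> k x Ix; exact: splice01.
Qed.

Let mKf : measurable_fun (@I01 R) Kf.
Proof.
apply: (@measurable_mean_lipschitz _ n kappa n0 kL (fun k x => orbit x k)).
  by move=> k; exact: measurable_iter_map.
by move=> k x Ix; exact: orbit01.
Qed.

Let B := `|kappa (fun=> 0)| + 1.

Let KzB p z x : (forall k, I01 (z k)) -> I01 x -> `|Kz p z x| <= B.
Proof.
by move=> z01 Ix; apply: (mean_lipschitz_bounded n0 kL) => k; exact: splice01.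
Qed.

Let KfB x : I01 x -> `|Kf x| <= B.
Proof.
by move=> Ix; apply: (mean_lipschitz_bounded n0 kL) => k; exact: orbit01.
Qed.

Let L1Kz p z : (forall k, I01 (z k)) -> L1 (Kz p z).
Proof. by move=> z01; exact: bounded_L1 (mKz p z01) (fun x => @KzB p z x z01). Qed.

Let L1Kf : L1 Kf. Proof. exact: bounded_L1 mKf KfB. Qed.

Lemma splice_step p z x : (forall k, I01 (z k)) -> I01 x ->
  `|Kz p.+1 z x - Kz p z x| <= n%:R^-1.
Proof.
move=> z01 Ix; apply: le_trans (kL _ _) _.
rewrite -[leRHS]mulr1 ler_wpM2l ?invr_ge0 ?ler0n//.
have h (k : nat) : `|splice p.+1 z x k - splice p z x k| <= (k == p)%:R.
  rewrite /splice ltnS leq_eqVlt; case: eqVneq => [->|kp] /=.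
    by rewrite ltnn; apply: I01_dist => //; exact: orbit01.
  by rewrite subrr normr0.
apply: (@le_trans _ _ (\sum_(k < n) ((k == p :> nat)%:R : R))).
  by apply: ler_sum => k _; exact: h.
have [pn|np] := ltnP p n.
  rewrite (bigD1 (Ordinal pn))//= eqxx big1 ?addr0// => k.
  by rewrite -val_eqE /= => /negbTE ->.
rewrite big1 ?ler01// => k _.
by rewrite ltn_eqF// (leq_trans (ltn_ord k)).
Qed.

Lemma splice_dist p z z' x e : (forall k, (k < n)%N -> `|z k - z' k| <= e) ->
  0 <= e -> `|Kz p z x - Kz p z' x| <= e.
Proof.
move=> zz' e0; apply: le_trans (kL _ _) _.
apply: (mean_le n0 (f := fun k => `|splice p z x k - splice p z' x k|)) => k kn.
by rewrite /splice; case: ifP => _; [rewrite subrr normr0|exact: zz'].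
Qed.

Lemma splice_orbit_dist p q z (i : bf_index (b q)) x y : (p <= q.+1)%N ->
  bf_dom i x -> bf_dom i y ->
  `|Kz p z (bf_inv i x) - Kz p z (bf_inv i y)| <= n%:R^-1 * (E * `|x - y|).
Proof.
move=> pq Dx Dy; apply: le_trans (kL _ _) _.
rewrite ler_wpM2l ?invr_ge0 ?ler0n//; apply: le_trans (gb_orbit (bP q) Dx Dy).
pose d k := `|orbit (bf_inv i x) k - orbit (bf_inv i y) k|.
apply: (@le_trans _ _ (\sum_(k < n | (k < q.+1)%N) d k)).
  rewrite [leRHS]big_mkcond/=; apply: ler_sum => k _; rewrite /splice.
  have [kp|pk] := ltnP k p; first by rewrite (leq_trans kp pq).
  by rewrite subrr normr0; case: ifP => // _; exact: normr_ge0.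
(* n and q + 1 come in no fixed order, so both sums are extended to the range n + q + 1. *)
rewrite (big_ord_widen_cond (n + q.+1) (fun k => (k < q.+1)%N) d) ?leq_addr//.
rewrite (big_ord_widen_cond (n + q.+1) xpredT d) ?leq_addl//.
rewrite big_mkcond [leRHS]big_mkcond/=; apply: ler_sum => k _.
by case: (k < q.+1)%N; case: (k < n)%N => //=; exact: normr_ge0.
Qed.

Lemma increment_decay p i z : (i <= p)%N -> (forall k, I01 (z k)) ->
  let h := fun x => Kz i.+1 z x - Kz i z x in
  {ae mu, forall x, I01 x -> `|Pi p (fun x => h x - mean h) x| <=
     2 * ((K0 + 1) * theta ^+ (p - i) * (c / n%:R))}.
Proof.
move=> ip z01 h.
have L1h : L1 h by exact: L1_B (L1Kz _ z01) (L1Kz _ z01).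
have hB x : I01 x -> `|h x| <= n%:R^-1 by exact: splice_step.
have ni0 : 0 <= n%:R^-1 :> R by rewrite invr_ge0 ler0n.
have mean0 : mean (fun x => h x - mean h) = 0.
  by rewrite (meanB L1h (L1_cst _)) mean_cst subrr.
have L1hm : L1 (fun x => h x - mean h) by exact: L1_B L1h (L1_cst _).
have normF : (norm_BV (Pi i (fun x => h x - mean h)%R) <= (c / n%:R)%:E)%E.
  apply: le_trans (branch_sum_norm_BV (B := 2 / n%:R) (Lf := 2 * E / n%:R)
    a0 _ _ (bP i) _ _ _) _.
  - by rewrite mulr_ge0.
  - by rewrite mulr_ge0// mulr_ge0.
  - exact: L1_measurable.
  - move=> x Ix; have := norm_mean_le L1h hB; have := hB x Ix.
    by have := ler_normB (h x) (mean h); lra.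
  - move=> j x y Dx Dy.
    (* Branches of T_1^i suffice for the i + 1 coordinates 0, ..., i: the last one is the end point
       itself. *)
    have h1 := @splice_orbit_dist i.+1 i z j x y (leqnn _) Dx Dy.
    have h2 := @splice_orbit_dist i i z j x y (leqnSn _) Dx Dy.
    have -> : h (bf_inv j x) - mean h - (h (bf_inv j y) - mean h) =
      (Kz i.+1 z (bf_inv j x) - Kz i.+1 z (bf_inv j y)) -
      (Kz i z (bf_inv j x) - Kz i z (bf_inv j y)) by rewrite /h; ring.
    apply: le_trans (ler_normB _ _) _; apply: le_trans (lerD h1 h2) _.
    by rewrite le_eqVlt; apply/orP; left; apply/eqP; ring.
  - rewrite lee_fin le_eqVlt; apply/orP; left; apply/eqP.
    by rewrite /c -/a; field; rewrite gt_eqF.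
have cn0 : 0 < c / n%:R by rewrite divr_gt0.
have BSp : branches (iter_map Ts (i + (p - i))) (@bf_dom (b p)) (@bf_inv (b p))
    (@bf_wt (b p)) by rewrite subnKC.
apply: (branch_sum_decay Dec th0 K00 cn0 CT nTs (BS i) BSp L1hm _ normF).
by rewrite meanE// mean0.
Qed.

(** The centred increments telescope to the centred kappa, and their bounds form a geometric series
    in theta. The null set still depends on z. *)
Lemma cond_exp_fixed p z : (forall k, I01 (z k)) ->
  {ae mu, forall x, I01 x ->
    `|Pi p (Kz p.+1 z) x - mean (Kz p.+1 z) * Pi p (cst 1) x| <= A / n%:R}.
Proof.
move=> z01.
pose h (i : nat) x := Kz i.+1 z x - Kz i z x.
pose F (i : nat) x := h i x - mean (h i).
have L1h i : L1 (h i) by exact: L1_B (L1Kz _ z01) (L1Kz _ z01).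
have KE q x : Kz q z x - mean (Kz q z) = \sum_(i < q) F i x.
  elim: q => [|q ih].
    rewrite big_ord0 (_ : (fun x => _) = cst (kappa z)) ?mean_cst ?subrr//.
  rewrite big_ord_recr/= -ih /F /h.
  rewrite (meanB (L1Kz q.+1 z01) (L1Kz q z01)); ring.
have : {ae mu, forall x, forall i, I01 x -> (i <= p)%N ->
    `|Pi p (F i) x| <= 2 * ((K0 + 1) * theta ^+ (p - i) * (c / n%:R))}.
  apply: aeC => i; have [ip|pi] := leqP i p.
    by have := increment_decay ip z01; apply: aeS => x H Ix _; exact: H.
  by apply: aeW => x _.
apply: aeS => x H Ix; have {}H i ip := H i Ix ip.
have -> : Pi p (Kz p.+1 z) x - mean (Kz p.+1 z) * Pi p (cst 1) x =
    \sum_(i < p.+1) Pi p (F i) x.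
  rewrite -branch_sum_sum -branch_sumZ -branch_sumB.
  congr (branch_sum _ _ _ _ x); apply/funext => y /=.
  by rewrite /cst mulr1 KE.
apply: le_trans (ler_norm_sum _ _ _) _.
apply: (@le_trans _ _ (\sum_(i < p.+1) 2 * ((K0 + 1) * theta ^+ (p - i) * (c / n%:R)))).
  by apply: ler_sum => i _; apply: H; rewrite -ltnS.
have -> : \sum_(i < p.+1) 2 * ((K0 + 1) * theta ^+ (p - i) * (c / n%:R)) =
    2 * (K0 + 1) * (c / n%:R) * \sum_(i < p.+1) theta ^+ (p - i).
  by rewrite mulr_sumr; apply: eq_bigr => i _; ring.
have -> : A / n%:R = 2 * (K0 + 1) * (c / n%:R) * (1 - theta)^-1.
  by rewrite /A; field; rewrite !gt_eqF.
rewrite ler_wpM2l ?geometric_le// mulr_ge0//; last by rewrite ltW// divr_gt0.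
by rewrite mulr_ge0// addr_ge0// ltW.
Qed.

(* The exceptional set must not depend on z, because z will be the orbit of x. *)
Lemma cond_exp_uniform p : {ae mu, forall x, I01 x ->
  forall z, (forall k, I01 (z k)) ->
    `|Pi p (Kz p.+1 z) x - mean (Kz p.+1 z) * Pi p (cst 1) x| <= 2 * A / n%:R}.
Proof.
have := aeC (fun m => cond_exp_fixed p (@rational_seq_I01 R m)).
apply: aeS => x H Ix z z01.
have P0 : 0 <= Pi p (cst 1) x.
  apply: sumr_ge0 => i _; rewrite patchE; case: ifPn => // /set_mem Dx.
  by rewrite /cst mul1r (br_wt (BS p) Dx).
(* Moving z to z' costs e times the density twice, in the sum and in the mean; this e makes the
   total at most A/n, and the added 1 keeps the divisor positive. *)
pose e := A / n%:R / (2 * (Pi p (cst 1) x + 1)).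
have P1 : 0 < Pi p (cst 1) x + 1 by lra.
have e0 : 0 < e.
  by apply: divr_gt0; [exact: divr_gt0|exact: mulr_gt0].
have [m me] := rational_seq_dense n e0 z01.
set z' := rational_seq m in me.
have z'01 k : I01 (z' k) by exact: rational_seq_I01.
have Kd y : I01 y -> `|(Kz p.+1 z \- Kz p.+1 z') y| <= e.
  by move=> _ /=; apply: splice_dist => //; exact: ltW.
have d1 := branch_sum_norm_le (BS p) x Kd.
rewrite branch_sumB in d1.
have d2 : `|mean (Kz p.+1 z) - mean (Kz p.+1 z')| <= e.
  rewrite -meanB; [|exact: L1Kz..].
  by apply: norm_mean_le Kd; exact: L1_B (L1Kz _ z01) (L1Kz _ z'01).
have d3 := H m Ix; rewrite -/z' in d3.
have eP : 2 * (e * Pi p (cst 1) x) <= A / n%:R.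
  have -> : A / n%:R = 2 * (e * (Pi p (cst 1) x + 1)).
    by rewrite /e; field; rewrite !gt_eqF//=; lra.
  by rewrite ler_wpM2l// ler_wpM2l// ?lerDl// ltW.
have -> : Pi p (Kz p.+1 z) x - mean (Kz p.+1 z) * Pi p (cst 1) x =
   (Pi p (Kz p.+1 z) x - Pi p (Kz p.+1 z') x) +
   (Pi p (Kz p.+1 z') x - mean (Kz p.+1 z') * Pi p (cst 1) x) -
   (mean (Kz p.+1 z) - mean (Kz p.+1 z')) * Pi p (cst 1) x by ring.
have d4 : `|(mean (Kz p.+1 z) - mean (Kz p.+1 z')) * Pi p (cst 1) x| <=
    e * Pi p (cst 1) x by rewrite normrM (ger0_norm P0) ler_wpM2r.
apply: le_trans (ler_normB _ _) _; apply: le_trans (lerD (ler_normD _ _) (lexx _)) _.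
have -> : 2 * A / n%:R = A / n%:R + A / n%:R by field; rewrite gt_eqF.
by lra.
Qed.

(* The conditional expectation of kappa along orbits given T_1^p, as a function
   of T_1^p x. The maximum only avoids a division by 0: almost everywhere the
   density is at least delta. *)
Definition cond_exp (p : nat) (x : R) : R :=
  Pi p Kf x * (Num.max delta (Pi p (cst 1) x))^-1.

Local Notation Y p := (fun x => cond_exp p (iter_map Ts p x)).

Let max0 p x : 0 < Num.max delta (Pi p (cst 1) x).
Proof. by rewrite lt_max delta0. Qed.

Let m1 : measurable_fun (@I01 R) (cst 1 : R -> R).
Proof. exact: measurable_cst. Qed.

Lemma measurable_cond_exp p : measurable_fun setT (cond_exp p).
Proof.
apply: measurable_funM; first exact: (measurable_branch_sum (BS p)).
have minv : measurable_fun setT (fun t : R => (Num.max delta t)^-1).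
  apply: nonincreasing_measurable => // s t st.
  have mx r : 0 < Num.max delta r by rewrite lt_max delta0.
  by rewrite lef_pV2 ?posrE// ge_max le_max lexx/= le_max st orbT.
exact: (measurableT_comp minv (measurable_branch_sum (BS p) m1)).
Qed.

Lemma cond_exp_bound p x : `|cond_exp p x| <= B.
Proof.
have mi : 0 < (Num.max delta (Pi p (cst 1) x))^-1 by rewrite invr_gt0.
rewrite /cond_exp normrM (gtr0_norm mi) ler_pdivrMr//.
have B0 : 0 <= B by rewrite /B; have := normr_ge0 (kappa (fun=> 0)); lra.
apply: le_trans (branch_sum_norm_le (BS p) x KfB) _.
by rewrite ler_wpM2l// le_max lexx orbT.
Qed.

Let mY p : measurable_fun (@I01 R) (Y p).
Proof. exact: (measurableT_comp (measurable_cond_exp p) (measurable_iter_map nTs p)). Qed.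

Let YB p x : I01 x -> `|Y p x| <= B.
Proof. by move=> _; exact: cond_exp_bound. Qed.

(** This is the defining property of a conditional expectation given T_1^p. Both integrals are
    pushed forward by the branch sum, where the density cancels: a.e. the maximum in [cond_exp] is
    the density. *)
Lemma cond_exp_dual p g : Linfty g ->
  mean (fun x => Y p x * g (iter_map Ts p x)) =
  mean (fun x => Kf x * g (iter_map Ts p x)).
Proof.
move=> Lg.
have Ly : Linfty (fun x => cond_exp p x * g x).
  have [mg [k gk]] := Lg; split.
    by apply: measurable_funM => //; apply: measurable_funTS; exact: measurable_cond_exp.
  exists (B * k); apply: aeS gk => x gkx Ix.
  by rewrite normrM ler_pM// ?cond_exp_bound// gkx.
have L1a := L1_mul_Linfty (L1_cst 1) (Linfty_iter nTs p Ly).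
have L1b := L1_mul_Linfty L1Kf (Linfty_iter nTs p Lg).
rewrite /mean; congr fine.
transitivity (\int[mu]_(x in @I01 R) ((cst 1 : R -> R) x *
    ((fun x => cond_exp p x * g x)%R \o iter_map Ts p) x)%:E)%E.
  by apply: eq_integral => x _; rewrite /cst mul1r.
have [La <-] := branch_sum_L1 (BS p) L1a.
have [Lb <-] := branch_sum_L1 (BS p) L1b.
apply: ae_eq_integral => //.
- by apply/measurable_EFinP; exact: L1_measurable.
- by apply/measurable_EFinP; exact: L1_measurable.
apply: aeS (density_ge p) => x dx Ix; congr (_%:E).
transitivity (Pi p (cst 1) x * (cond_exp p x * g x)).
  exact: (branch_sum_mul (BS p) (cst 1) (fun x => cond_exp p x * g x) x).
transitivity (Pi p Kf x * g x); last first.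
  exact: esym (branch_sum_mul (BS p) Kf g x).
rewrite /cond_exp (max_idPr (dx Ix)) mulrCA mulrA; congr (_ * _).
by rewrite divfK// gt_eqF// (lt_le_trans delta0 (dx Ix)).
Qed.

(** The error of [cond_exp_uniform] after division by a density that is at least delta. *)
Let A1 := 2 * A / delta.

Let A10 : 0 < A1. Proof. by rewrite divr_gt0// mulr_gt0. Qed.

Lemma cond_exp_close p : {ae mu, forall x, I01 x ->
  `|Y p x - mean (Kz p.+1 (orbit x))| <= A1 / n%:R}.
Proof.
have good := aeI (density_ge p) (cond_exp_uniform p).
(* The estimates hold at almost every y; nonsingularity pulls them back to y = T_1^p x for almost
   every x. *)
have : {ae mu, forall y, I01 y -> delta <= Pi p (cst 1) y /\
  forall z, (forall k, I01 (z k)) ->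
    `|Pi p (Kz p.+1 z) y - mean (Kz p.+1 z) * Pi p (cst 1) y| <= 2 * A / n%:R}.
  by apply: aeS good => y [h1 h2] Iy; split; [exact: h1|exact: h2].
move=> /(iter_map_ae nTs p); apply: aeS => x H Ix.
have [dx {}H] := H Ix; have {}H := H _ (fun k => orbit01 k Ix).
set y := iter_map Ts p x in dx H *.
(* Every preimage of y under T_1^p follows the orbit of x from time p on, so on this fibre kappa
   equals its splice with that orbit. *)
have KfE : Pi p Kf y = Pi p (Kz p.+1 (orbit x)) y.
  apply: eq_bigr => i _; rewrite !patchE; case: ifPn => // /set_mem Dy.
  congr (kappa _ * _); apply/funext => k; rewrite /splice.
  have [//|pk] := ltnP k p.+1.
  rewrite /orbit -(subnKC (ltnW pk)) !iter_map_shift.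
  by have [_ ->] := br_inv (BS p) Dy.
rewrite /cond_exp KfE (max_idPr dx).
set P := Pi p (cst 1) y in dx H *.
have P0 : 0 < P by exact: lt_le_trans dx.
set e := mean _ in H *; set q := Pi p _ y in H *.
have -> : q / P - e = (q - e * P) / P by field; rewrite gt_eqF.
rewrite normrM normfV (gtr0_norm P0) ler_pdivrMr//; apply: le_trans H _.
have -> : 2 * A / n%:R = A1 / n%:R * delta by rewrite /A1; field; rewrite !gt_eqF.
by rewrite ler_wpM2l// divr_ge0// ?ltW.
Qed.

(** Twice A1 for replacing Y_p and Y_(p+1) by means of splices, and 1 for the coordinate by which
    these two splices differ. *)
Let Dl := 2 * A1 + 1.

Lemma cond_exp_increment p : {ae mu, forall x, I01 x ->
  `|Y p x - Y p.+1 x| <= Dl / n%:R}.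
Proof.
have := aeI (cond_exp_close p) (cond_exp_close p.+1).
apply: aeS => x [h1 h2] Ix; have {}h1 := h1 Ix; have {}h2 := h2 Ix.
have z01 k : I01 (orbit x k) by exact: orbit01.
have h3 : `|mean (Kz p.+2 (orbit x)) - mean (Kz p.+1 (orbit x))| <= n%:R^-1.
  rewrite -meanB; [|exact: L1Kz..].
  apply: norm_mean_le; first by apply: L1_B; exact: L1Kz.
  by move=> y Iy; exact: splice_step.
have -> : Dl / n%:R = A1 / n%:R + A1 / n%:R + n%:R^-1.
  by rewrite /Dl; field; rewrite gt_eqF.
move: h1 h2 h3; rewrite !ler_norml => /andP[? ?] /andP[? ?] /andP[? ?].
by apply/andP; split; lra.
Qed.

(** [b 0] may be any system of branches of the identity; by duality its sum gives back the function
    a.e. *)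
Lemma cond_exp0 : ae_eq mu (@I01 R) (Y 0) Kf.
Proof.
have e1 := iter_transfer_branch_sum nTs (BS 0) L1Kf.
have e2 := iter_transfer_branch_sum nTs (BS 0) (L1_cst 1).
apply: aeS (aeI (density_ge 0) (aeI e1 e2)) => x [h [h1 h2]] Ix.
rewrite /cond_exp /= (max_idPr (h Ix)) -(h1 Ix) -(h2 Ix) /=.
by rewrite /cst invr1 mulr1.
Qed.

Lemma cond_exp_mgf_step p s :
  mean (fun x => expR (s * Y p x)) <=
    expR (2 * (s * (Dl / n%:R)) ^+ 2) * mean (fun x => expR (s * Y p.+1 x)).
Proof.
apply: (azuma_step (mY p) (mY p.+1) (@YB p) (@YB p.+1) (cond_exp_increment p)).
have Lg : Linfty (fun x => expR (s * cond_exp p.+1 x)).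
  apply: (@Linfty_expR _ _ B); last by move=> x _; exact: cond_exp_bound.
  by apply: measurable_funTS; exact: measurable_cond_exp.
(* Both means equal that of kappa times exp(s Y_(p+1)): the exponential is a function of T_1^(p+1)
   x, hence also of T_1^p x. *)
rewrite [RHS](cond_exp_dual p.+1 Lg).
exact: (cond_exp_dual p (Linfty_comp (nTs (ltn0Sn p)) Lg)).
Qed.

Lemma mean_cond_exp p : mean (Y p) = mean Kf.
Proof.
have L1 : Linfty (cst 1 : R -> R) by apply: (@bounded_Linfty _ _ 1) => // x _; rewrite normr1.
have := cond_exp_dual p L1.
by rewrite /cst; under eq_fun do rewrite mulr1; under [in RHS]eq_fun do rewrite mulr1.
Qed.

(** At time n every coordinate seen by kappa lies in the unfrozen part of the splice, so the mean in
    [cond_exp_close] is the constant E kappa. One Azuma step then leads from Y_n to that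
    constant. *)
Lemma cond_exp_mgf_last s :
  mean (fun x => expR (s * Y n x)) <=
    expR (2 * (s * (Dl / n%:R)) ^+ 2) * expR (s * mean Kf).
Proof.
rewrite -[X in _ * X]mean_cst.
have mB : `|mean Kf| <= B by exact: norm_mean_le L1Kf KfB.
have L1Y : L1 (Y n) by exact: bounded_L1 (mY n) (@YB n).
apply: (azuma_step (Z := cst (mean Kf)) (mY n) _ (@YB n) (fun _ _ => mB)).
- exact: measurable_cst.
- apply: aeS (cond_exp_close n) => x H Ix; have {}H := H Ix.
  have KE : Kz n.+1 (orbit x) = Kf.
    apply/funext => y; apply/eqP; rewrite -subr_eq0 -normr_le0.
    apply: le_trans (kL _ _) _; rewrite big1 ?mulr0// => k _.
    by rewrite /splice ltnS (ltnW (ltn_ord k)) subrr normr0.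
  rewrite KE in H; apply: le_trans H _.
  rewrite ler_wpM2r ?invr_ge0 ?ler0n// /Dl; have := A10; lra.
- rewrite /cst.
  under eq_fun do rewrite mulrC; under [in RHS]eq_fun do rewrite mulrC.
  by rewrite meanZ// mean_cond_exp [RHS](mean_cst (expR (s * mean Kf) * mean Kf)).
Qed.

Lemma mean_lipschitz_mgf s : mean (fun x => expR (s * Kf x)) <=
  expR (4 * Dl ^+ 2 / n%:R * s ^+ 2) * expR (s * mean Kf).
Proof.
have step p : mean (fun x => expR (s * Y 0 x)) <=
    expR (2 * (s * (Dl / n%:R)) ^+ 2) ^+ p * mean (fun x => expR (s * Y p x)).
  elim: p => [|p ih]; first by rewrite expr0 mul1r.
  apply: le_trans ih _; rewrite [expR _ ^+ p.+1]exprSr -mulrA.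
  rewrite ler_wpM2l ?exprn_ge0 ?expR_ge0//.
  exact: cond_exp_mgf_step.
have -> : mean (fun x => expR (s * Kf x)) = mean (fun x => expR (s * Y 0 x)).
  apply: ae_eq_mean.
  - exact: L1_expR mKf KfB.
  - exact: L1_expR (mY 0) (@YB 0).
  - by apply: aeS cond_exp0 => x H Ix; rewrite H.
apply: le_trans (step n) _.
apply: le_trans (ler_wpM2l _ (cond_exp_mgf_last s)) _.
  by rewrite exprn_ge0// expR_ge0.
rewrite [leLHS]mulrA -exprSr ler_wpM2r ?expR_ge0// -expRM_natl ler_expR.
(* There are n + 1 factors, the last coming from [cond_exp_mgf_last]; n + 1 <= 2n turns the constant
   2 into 4. *)
have -> : 4 * Dl ^+ 2 / n%:R * s ^+ 2 = (2 * n%:R) * (2 * (s * (Dl / n%:R)) ^+ 2).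
  by field; rewrite gt_eqF.
have sq0 : 0 <= 2 * (s * (Dl / n%:R)) ^+ 2 by apply: mulr_ge0 => //; exact: sqr_ge0.
rewrite ler_wpM2r// -natr1.
have : 1 <= n%:R :> R by rewrite ler1n.
by lra.
Qed.

End concentration.

(** * Distance to a set of orbits *)

Section deviation.
Context {R : realType}.
Local Notation mu := (@lebesgue_measure R).
Let m01 : @measurable _ (measurableTypeR R) (@I01 R) := @measurable_I01 R.

Lemma mean_indic (A : set R) : measurable A -> A `<=` @I01 R ->
  L1 (\1_A : R -> R) /\ mu A = (mean (\1_A))%:E.
Proof.
move=> mA A01.
have L1A : L1 (\1_A : R -> R).
  apply: (@bounded_L1 _ _ 1); first exact: measurable_funTS.
  by move=> x _; rewrite indicE; case: (_ \in _); rewrite ?normr1 ?normr0.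
split => //; rewrite -meanE// integral_indic// (setIidl A01)//.
Qed.

Lemma chernoff (F : R -> R) (B r s : R) : measurable_fun (@I01 R) F ->
  (forall x, I01 x -> `|F x| <= B) -> 0 <= s ->
  (mu (@I01 R `&` [set x | (r < F x)%R]) <=
    (expR (- (s * r)) * mean (fun x => expR (s * F x)))%:E)%E.
Proof.
move=> mF FB s0; set D := _ `&` _.
have mD : measurable D.
  have -> : D = @I01 R `&` F @^-1` `]r, +oo[%classic.
    by apply/seteqP; split => x [Ix /=] h; split => //=; move: h; rewrite in_itv/= andbT.
  by apply: mF => //; exact: measurable_itv.
have D01 : D `<=` @I01 R by move=> x [].
have [L1D ->] := mean_indic mD D01.
have L1e := L1_expR s mF FB.
rewrite lee_fin -meanZ//; apply: le_mean => //; first exact: L1_Z.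
move=> x Ix; rewrite -expRD indicE; case: (boolP (x \in D)) => [/set_mem[_ /= rF]|_].
  by rewrite -expR0 ler_expR addrC -mulrBr mulr_ge0// subr_ge0 ltW.
by rewrite expR_ge0.
Qed.

Section inf_dist.
Variables (Ts : nat -> R -> R) (A : set R) (n : nat).
Hypotheses (A0 : A !=set0).

(** Z_n extended from orbits to arbitrary sequences, which makes it mean-Lipschitz; along the orbit
    of x it is [orbit_dist_to]. *)
Definition dist_to_orbits (xi : nat -> R) : R :=
  inf [set n%:R^-1 * \sum_(0 <= k < n) `|xi k - iter_map Ts k y| | y in A].

Let term_ge0 xi y : 0 <= n%:R^-1 * \sum_(0 <= k < n) `|xi k - iter_map Ts k y|.
Proof. by rewrite mulr_ge0 ?invr_ge0 ?ler0n// sumr_ge0. Qed.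

Let dist_le xi y : A y ->
  dist_to_orbits xi <= n%:R^-1 * \sum_(0 <= k < n) `|xi k - iter_map Ts k y|.
Proof.
move=> Ay; apply: ge_inf; last by exists y.
by exists 0 => _ [y' _ <-]; exact: term_ge0.
Qed.

Let dist_ge xi (r : R) :
  (forall y, A y -> r <= n%:R^-1 * \sum_(0 <= k < n) `|xi k - iter_map Ts k y|) ->
  r <= dist_to_orbits xi.
Proof.
move=> h; apply: lb_le_inf; last by move=> _ [y Ay <-]; exact: h.
by have [y Ay] := A0; eexists; exists y.
Qed.

Lemma dist_to_orbits_ge0 xi : 0 <= dist_to_orbits xi.
Proof. by apply: dist_ge => y _; exact: term_ge0. Qed.

Lemma dist_to_orbits_eq0 y : A y -> dist_to_orbits (fun k => iter_map Ts k y) = 0.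
Proof.
move=> Ay; apply/eqP; rewrite eq_le dist_to_orbits_ge0 andbT.
apply: le_trans (dist_le _ Ay) _.
by rewrite big1 ?mulr0// => k _; rewrite subrr normr0.
Qed.

Lemma dist_to_orbits_lipschitz : mean_lipschitz n dist_to_orbits.
Proof.
have half xi xi' : dist_to_orbits xi - dist_to_orbits xi' <=
    n%:R^-1 * \sum_(k < n) `|xi k - xi' k|.
  rewrite lerBlDl -lerBlDr; apply: dist_ge => y Ay; rewrite lerBlDr.
  apply: le_trans (dist_le xi Ay) _.
  rewrite -mulrDr ler_wpM2l ?invr_ge0 ?ler0n// !big_mkord -big_split/=.
  by apply: ler_sum => k _; rewrite addrC; exact: ler_distD.
move=> xi xi'; rewrite ler_norml half andbT lerNl opprB.
by apply: le_trans (half xi' xi) _; under eq_bigr do rewrite distrC.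
Qed.

End inf_dist.

Lemma mgf_exists (C : set (R -> R)) (part : (R -> R) -> set (set R))
  (hC : forall T, C T -> piecewise_expanding T (part T))
  (hD : exists2 r : nat, (1 <= r)%N & cond_D C r)
  (hDec : cond_Dec C)
  (hderiv : exists lambda M : R, [/\ 1 < lambda, 1 <= M &
     forall T, C T -> (lambda%:E <= inf_abs_deriv T (part T))%E /\
                      (sup_abs_deriv2 T (part T) <= M%:E)%E])
  (hcard : exists2 N : nat, (1 <= N)%N & forall T, C T -> part T #<= `I_N)
  (Ts : nat -> R -> R)
  (hTs : forall n, (1 <= n)%N -> C (Ts n))
  (hMin : cond_Min Ts) :
  (forall n, (1 <= n)%N -> nonsingular_map (Ts n)) /\
  exists2 V : R, 0 < V & forall n kappa s, (0 < n)%N -> mean_lipschitz n kappa ->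
    mean (fun x => expR (s * kappa (orbit Ts x))) <=
    expR (V / n%:R * s ^+ 2) * expR (s * mean (fun x => kappa (orbit Ts x))).
Proof.
have [la [M [la1 M1 hlaM]]] := hderiv.
have [N _ hN] := hcard.
have [r r1 DC] := hD.
have [theta [K0 [th01 K00 Dec]]] := hDec.
have [delta delta0 hdelta] := hMin.
have M0 : 0 <= M by exact: le_trans M1.
have sys n : (1 <= n)%N ->
    exists U K tau w, @expanding_system R (Ts n) la M N U K tau w.
  move=> /hTs CT; have [h1 h2] := hlaM _ CT.
  exact: (expanding_system_exists la1 (hC _ CT) h1 h2 (hN _ CT)).
have nTs n : (1 <= n)%N -> nonsingular_map (Ts n).
  move=> n1; have [U [K [tau [w es]]]] := sys n n1.
  by apply: (expanding_system_nonsingular es); case: (hC _ (hTs _ n1)).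
split=> //.
have [C4 C40 aeC4] := branch_sum_cst1_bound sys nTs r1 DC hTs.
have gb := good_branches_exist la1 M0 sys C40 aeC4.
set W := 1 + _ in gb.
have W0 : 0 <= W.
  rewrite addr_ge0// divr_ge0//; last by rewrite subr_ge0 ltW.
  by rewrite mulr_ge0// mulr_ge0// expR_ge0.
have /choice[b bP] : forall p, exists b : branch_family, good_branches Ts la M p W
    (@bf_dom _ b) (@bf_inv _ b) (@bf_wt _ b).
  by move=> p; have [J [D [inv [wt g]]]] := gb p; exists (BranchFamily D inv wt).
(* (Min) concerns n >= 1; at time 0 the density is 1. *)
pose delta' := Num.min delta 1.
have delta'0 : 0 < delta' by rewrite lt_min delta0 ltr01.
have dens p : {ae mu, forall x, I01 x -> delta' <=
    branch_sum (@bf_dom _ (b p)) (@bf_inv _ (b p)) (@bf_wt _ (b p)) (cst 1) x}.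
  have e := iter_transfer_branch_sum nTs (gb_branches (bP p)) (L1_cst 1).
  case: p e => [|p] e.
    apply: aeS e => x h Ix; rewrite -(h Ix) /=.
    by rewrite /delta' ge_min lexx orbT.
  apply: aeS (aeI e (hdelta p.+1 isT)) => x [h1 h2] Ix; rewrite -(h1 Ix).
  by apply: le_trans (h2 Ix); rewrite ge_min lexx.
have := mean_lipschitz_mgf la1 M0 W0 hTs nTs th01 K00 Dec bP delta'0 dens.
set Dl := (2 * _ + 1 : R) => mgf.
exists (4 * Dl ^+ 2); last by move=> n kappa s n0 kL; exact: mgf.
have /andP[th0 th1] := th01.
have la10 : 0 < la - 1 by rewrite subr_gt0.
have la0 : 0 < la by exact: lt_trans la1.
have E0 : 0 <= la / (la - 1) by rewrite divr_ge0// ltW.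
have ea0 : 0 <= M / (la - 1) * expR (M / (la - 1)).
  by rewrite mulr_ge0 ?expR_ge0// divr_ge0// ltW.
rewrite mulr_gt0// exprn_gt0// ltr_wpDl//.
apply: mulr_ge0 => //; apply: divr_ge0; last exact: ltW.
apply: mulr_ge0 => //; apply: divr_ge0; last by lra.
apply: mulr_ge0; first by lra.
by apply: addr_ge0 => //; apply: mulr_ge0 => //; lra.
Qed.

Lemma orbit_distance_deviation (Ts : nat -> R -> R) (V : R) : 0 < V ->
  (forall n, (1 <= n)%N -> nonsingular_map (Ts n)) ->
  (forall n kappa s, (0 < n)%N -> mean_lipschitz n kappa ->
    mean (fun x => expR (s * kappa (orbit Ts x))) <=
    expR (V / n%:R * s ^+ 2) * expR (s * mean (fun x => kappa (orbit Ts x)))) ->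
  forall (A : set R) (n : nat) (t : R), measurable A -> A `<=` @I01 R ->
  (0 < mu A)%E -> (1 <= n)%N -> 0 < t ->
  (mu (@I01 R `&` [set x | (2 * Num.sqrt V *
      (Num.sqrt `|ln (fine (mu A))| / Num.sqrt n%:R) + t / Num.sqrt n%:R <
      orbit_dist_to Ts A n x)%R])
    <= (expR (- (4 * V)^-1 * t ^+ 2))%:E)%E.
Proof.
move=> V0 nTs mgf A n t mA A01 muA n0 t0.
have nR0 : 0 < n%:R :> R by rewrite ltr0n.
have A0 : A !=set0.
  apply/set0P/eqP => A0; move: muA; rewrite A0 measure0.
  by rewrite ltxx.
pose kappa := @dist_to_orbits Ts A n.
have kL : mean_lipschitz n kappa by exact: dist_to_orbits_lipschitz.
have NkL : mean_lipschitz n (fun xi => - kappa xi).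
  by move=> xi xi'; rewrite -opprD normrN; exact: kL.
pose Z x := kappa (orbit Ts x).
have mZ : measurable_fun (@I01 R) Z.
  apply: (@measurable_mean_lipschitz R n kappa n0 kL (fun k x => orbit Ts x k)).
    by move=> k; exact: measurable_iter_map.
  by move=> k x Ix; exact: iter_map_I01.
pose B := `|kappa (fun=> 0)| + 1.
have ZB x : I01 x -> `|Z x| <= B.
  move=> Ix; apply: (mean_lipschitz_bounded n0 kL) => k; exact: iter_map_I01.
have L1Z' : L1 Z by exact: bounded_L1 mZ ZB.
pose m := mean Z.
have m0 : 0 <= m.
  rewrite -(@mean_cst R 0); apply: le_mean => //; first exact: L1_cst.
  by move=> x _; exact: dist_to_orbits_ge0.
have [L1A muAE] := mean_indic mA A01.
pose al := mean (\1_A).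
have alE : fine (mu A) = al by rewrite muAE.
have al0 : 0 < al by rewrite -lte_fin -muAE.
have al1 : al <= 1.
  rewrite -[leRHS](@mean_cst R 1); apply: le_mean => //; first exact: L1_cst.
  by move=> x _; rewrite indicE /cst; case: (_ \in _).
pose L := - ln al.
have L0 : 0 <= L by rewrite oppr_ge0 ln_le0.
have LE : `|ln (fine (mu A))| = L by rewrite alE ler0_norm// ln_le0.
(* Z vanishes on A, so the Laplace transform of - Z is at least mu A *)
have mL : m ^+ 2 * n%:R <= 4 * V * L.
  (* Minimises V s^2/n - s m; the minimum -m^2 n/(4V) is then compared with log m(A). *)
  pose s := m * n%:R / (2 * V).
  have s0 : 0 <= s by rewrite divr_ge0 ?mulr_ge0// ltW.
  have lower : al <= mean (fun x => expR (s * - Z x)).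
    apply: le_mean => //.
      apply: (@L1_expR _ _ B); first exact: measurableT_comp.
      by move=> x Ix; rewrite normrN ZB.
    move=> x Ix; rewrite indicE; case: (boolP (x \in A)) => [/set_mem Ax|_].
      by rewrite /Z /kappa dist_to_orbits_eq0// oppr0 mulr0 expR0.
    exact: expR_ge0.
  have := le_trans lower (mgf n _ s n0 NkL).
  have -> : mean (fun x => - kappa (orbit Ts x)) = - m.
    rewrite -mulN1r -meanZ//; congr mean; apply/funext => x.
    by rewrite mulN1r.
  rewrite -expRD -(lnK al0) ler_expR -/L -[ln al]opprK -/L.
  have -> : V / n%:R * s ^+ 2 + s * - m = - (m ^+ 2 * n%:R / (4 * V)).
    by rewrite /s; field; rewrite !gt_eqF.
  by rewrite lerN2 ler_pdivrMr ?mulr_gt0// [X in _ <= X -> _]mulrC.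
have sn0 : 0 < Num.sqrt n%:R :> R by rewrite sqrtr_gt0.
have mC : m <= 2 * Num.sqrt V * (Num.sqrt L / Num.sqrt n%:R).
  rewrite mulrA ler_pdivlMr//.
  rewrite -(@ler_pXn2r _ 2)// ?nnegrE ?mulr_ge0 ?sqrtr_ge0//.
  rewrite !exprMn !sqr_sqrtr ?ler0n ?(ltW V0)//.
  by apply: le_trans mL _; rewrite le_eqVlt; apply/orP; left; apply/eqP; ring.
pose u := t / Num.sqrt n%:R.
have u0 : 0 < u by rewrite divr_gt0.
(* Minimises V s^2/n - s u; the minimum is -u^2 n/(4V) = -t^2/(4V). *)
pose s := u * n%:R / (2 * V).
have s0 : 0 <= s by rewrite divr_ge0 ?mulr_ge0// ltW.
rewrite LE -/u.
set r := _ + u.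
have := chernoff r mZ ZB s0.
move=> /le_trans; apply; rewrite lee_fin.
apply: le_trans (ler_wpM2l (expR_ge0 _) (mgf n kappa s n0 kL)) _.
rewrite -!expRD ler_expR -/Z -/m.
have : s * (m + u) <= s * r by rewrite ler_wpM2l// lerD2r.
have -> : - (4 * V)^-1 * t ^+ 2 = - (s * (m + u)) + (V / n%:R * s ^+ 2 + s * m).
  have -> : t ^+ 2 = u ^+ 2 * n%:R.
    by rewrite /u exprMn exprVn sqr_sqrtr ?ltW// divfK// gt_eqF.
  by rewrite /s; field; rewrite !gt_eqF.
by lra.
Qed.

End deviation.

Unset Implicit Arguments.
Set Strict Implicit.

Theorem proposition11 (R : realType)
  (C : set (R -> R)) (part : (R -> R) -> set (set R))
  (hC : forall T, C T -> piecewise_expanding T (part T))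
  (hD : exists2 r : nat, (1 <= r)%N & cond_D C r)
  (hDec : cond_Dec C)
  (hderiv : exists lambda M : R, [/\ 1 < lambda, 1 <= M &
     forall T, C T -> (lambda%:E <= inf_abs_deriv T (part T))%E /\
                      (sup_abs_deriv2 T (part T) <= M%:E)%E])
  (hcard : exists2 N : nat, (1 <= N)%N & forall T, C T -> part T #<= `I_N)
  (Ts : nat -> R -> R)
  (hTs : forall n, (1 <= n)%N -> C (Ts n))
  (hMin : cond_Min Ts) :
  exists C1 C2 : R, [/\ 0 < C1, 0 < C2 &
    forall A : set R, measurable A -> A `<=` @I01 R -> (0 < lebesgue_measure A)%E ->
    forall n : nat, (1 <= n)%N -> forall t : R, 0 < t ->
      (lebesgue_measure (@I01 R `&` [set x | (C1 * (Num.sqrt `|ln (fine (lebesgue_measure A))| / Num.sqrt n%:R)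
                      + t / Num.sqrt n%:R < orbit_dist_to Ts A n x)%R])
        <= (expR (- C2 * t ^+ 2))%:E)%E].
Proof.
have [nTs [V V0 mgf]] := mgf_exists hC hD hDec hderiv hcard hTs hMin.
(* C1 comes from the bound on the mean of Z_n, C2 from the optimised Chernoff exponent. *)
exists (2 * Num.sqrt V), (4 * V)^-1; split.
- by rewrite mulr_gt0// sqrtr_gt0.
- by rewrite invr_gt0 mulr_gt0.
- move=> A mA A01 muA n n0 t t0.
  exact: (orbit_distance_deviation V0 nTs mgf mA A01 muA n0 t0).
Qed.
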